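(* Let $(H,\Delta,\varepsilon,\Phi,\ell,r,\mathcal{R})$ be a quasitriangular quasi-bialgebra and let $({}_H\mathcal{M},\otimes,\sigma)$ be the corresponding braided monoidal category of left $H$-modules. Then there is a bijective correspondence between infinitesimal $\mathcal{R}$-matrices $\chi\in H\otimes H$ of $H$ (pre-Cartier structures on $H$) and infinitesimal braidings $t$ of $({}_H\mathcal{M},\otimes,\sigma)$ (pre-Cartier structures on ${}_H\mathcal{M}$). Explicitly, given an infinitesimal $\mathcal{R}$-matrix $\chi\in H\otimes H$, the infinitesimal braiding is $$t_{X,Y}\colon X\otimes Y\to X\otimes Y,\qquad t_{X,Y}(x\otimes y)=\chi\cdot(x\otimes y),$$ for left $H$-modules $X,Y$, while $\chi$ is recovered from $t$ via $\chi=t_{H,H}(1\otimes 1)$.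
   Context: $\Bbbk$ is a field of characteristic zero; all algebras are associative unital $\Bbbk$-algebras, all maps are $\Bbbk$-linear, $\otimes=\otimes_\Bbbk$, and $\tau$ is the tensor flip. Leg notation: for $A=\sum A^1\otimes A^2\in H\otimes H$, put $A^{\mathrm{op}}=\tau(A)$, $A_{12}=A\otimes 1$, $A_{23}=1\otimes A$, $A_{13}=\sum A^1\otimes 1\otimes A^2$. For $\Phi=\sum\Phi^1\otimes\Phi^2\otimes\Phi^3\in H^{\otimes 3}$ and a permutation $(i,j,k)$ of $(1,2,3)$, put $\Phi_{ijk}=\sum\Phi^i\otimes\Phi^j\otimes\Phi^k$. A quasi-bialgebra is an algebra $H$ with algebra morphisms $\Delta\colon H\to H\otimes H$, $\varepsilon\colon H\to\Bbbk$ and invertible elements $\Phi\in H^{\otimes 3}$, $\ell,r\in H$ such that for all $h\in H$: $(\mathrm{id}\otimes\Delta)\Delta(h)=\Phi\,(\Delta\otimes\mathrm{id})\Delta(h)\,\Phi^{-1}$, $(\varepsilon\otimes\mathrm{id})\Delta(h)=\ell^{-1}h\ell$, $(\mathrm{id}\otimes\varepsilon)\Delta(h)=r^{-1}hr$, and $(\mathrm{id}\otimes\mathrm{id}\otimes\Delta)(\Phi)(\Delta\otimes\mathrm{id}\otimes\mathrm{id})(\Phi)=(1\otimes\Phi)(\mathrm{id}\otimes\Delta\otimes\mathrm{id})(\Phi)(\Phi\otimes 1)$, $(\mathrm{id}\otimes\varepsilon\otimes\mathrm{id})(\Phi)=r\otimes\ell^{-1}$. It is quasitriangular if it is endowed with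 an invertible $\mathcal{R}\in H\otimes H$ with $\Delta^{\mathrm{op}}(\cdot)=\mathcal{R}\Delta(\cdot)\mathcal{R}^{-1}$, $(\mathrm{id}\otimes\Delta)(\mathcal{R})=\Phi_{312}^{-1}\mathcal{R}_{13}\Phi_{213}\mathcal{R}_{12}\Phi^{-1}$, $(\Delta\otimes\mathrm{id})(\mathcal{R})=\Phi_{231}\mathcal{R}_{13}\Phi_{132}^{-1}\mathcal{R}_{23}\Phi$. An infinitesimal $\mathcal{R}$-matrix of a quasitriangular quasi-bialgebra is an element $\chi\in H\otimes H$ with $\chi\Delta(\cdot)=\Delta(\cdot)\chi$, $(\mathrm{id}\otimes\Delta)(\chi)=\Phi\mathcal{R}_{12}^{-1}\Phi_{213}^{-1}\chi_{13}\Phi_{213}\mathcal{R}_{12}\Phi^{-1}+\Phi\chi_{12}\Phi^{-1}$, $(\Delta\otimes\mathrm{id})(\chi)=\Phi^{-1}\mathcal{R}_{23}^{-1}\Phi_{132}\chi_{13}\Phi_{132}^{-1}\mathcal{R}_{23}\Phi+\Phi^{-1}\chi_{23}\Phi$. The category ${}_H\mathcal{M}$ of left $H$-modules is braided monoidal: $H$ acts on $X\otimes Y$ through $\Delta$ and on the unit $\Bbbk$ through $\varepsilon$; $a_{X,Y,Z}((x\otimes y)\otimes z)=\Phi\cdot(x\otimes(y\otimes z))$, $\ell_X(1\otimes x)=\ell\cdot x$, $r_X(x\otimes 1)=r\cdot x$, $\sigma_{X,Y}(x\otimes y)=\mathcal{R}^{\mathrm{op}}\cdot(y\otimes x)$.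 An infinitesimal braiding of a pre-additive braided monoidal category $(\mathcal{C},\otimes,I,a,\ell,r,\sigma)$ is a natural transformation $t\colon\otimes\Rightarrow\otimes$ such that for all objects $X,Y,Z$: $$t_{X,Y\otimes Z}=a_{X,Y,Z}(t_{X,Y}\otimes\mathrm{id}_Z)a_{X,Y,Z}^{-1}+a_{X,Y,Z}(\sigma_{X,Y}^{-1}\otimes\mathrm{id}_Z)a_{Y,X,Z}^{-1}(\mathrm{id}_Y\otimes t_{X,Z})a_{Y,X,Z}(\sigma_{X,Y}\otimes\mathrm{id}_Z)a_{X,Y,Z}^{-1},$$ $$t_{X\otimes Y,Z}=a_{X,Y,Z}^{-1}(\mathrm{id}_X\otimes t_{Y,Z})a_{X,Y,Z}+a_{X,Y,Z}^{-1}(\mathrm{id}_X\otimes\sigma_{Y,Z}^{-1})a_{X,Z,Y}(t_{X,Z}\otimes\mathrm{id}_Y)a_{X,Z,Y}^{-1}(\mathrm{id}_X\otimes\sigma_{Y,Z})a_{X,Y,Z}.$$ *)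

(* Defs.v *)
From HB Require Import structures.
From mathcomp Require Import all_boot all_order all_algebra.
From mathcomp Require Import boolp classical_sets.

Set Implicit Arguments.
Unset Strict Implicit.
Unset Printing Implicit Defensive.

Import GRing.Theory.
Local Open Scope ring_scope.
Local Open Scope quotient_scope.

Reserved Notation "x \ox y" (at level 40, left associativity).

Section TensorProduct.
Variables (k : fieldType) (V W : lmodType k).

(* A list of pairs stands for the formal sum of the corresponding pure tensors;
   scalars are absorbed into the first component. *)
Inductive tens_rel : seq (V * W) -> seq (V * W) -> Prop :=
| TensRefl s : tens_rel s s
| TensSym s t : tens_rel s t -> tens_rel t s
| TensTrans s t u : tens_rel s t -> tens_rel t u -> tens_rel s u
| TensCat s s' t t' :
    tens_rel s s' -> tens_rel t t' -> tens_rel (s ++ t) (s' ++ t')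
| TensCatC s t : tens_rel (s ++ t) (t ++ s)
| TensAddl x x' y : tens_rel [:: (x + x', y)] [:: (x, y); (x', y)]
| TensAddr x y y' : tens_rel [:: (x, y + y')] [:: (x, y); (x, y')]
| TensScale a x y : tens_rel [:: (a *: x, y)] [:: (x, a *: y)]
| TensZero y : tens_rel [:: (0, y)] [::].

Definition tens_eqb (s t : seq (V * W)) : bool := `[< tens_rel s t >].

Lemma tens_eqb_refl : reflexive tens_eqb.
Proof. by move=> s; apply/asboolP; apply: TensRefl. Qed.
Lemma tens_eqb_sym : symmetric tens_eqb.
Proof. by move=> s t; apply/asboolP/asboolP; apply: TensSym. Qed.
Lemma tens_eqb_trans : transitive tens_eqb.
Proof. by move=> t s u /asboolP h /asboolP h'; apply/asboolP/(TensTrans h). Qed.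

Canonical tens_equiv :=
  EquivRel tens_eqb tens_eqb_refl tens_eqb_sym tens_eqb_trans.

Definition tens : Type := {eq_quot tens_equiv}.
HB.instance Definition _ := Choice.on tens.

Definition tens_pi (s : seq (V * W)) : tens := \pi_({eq_quot tens_equiv}) s.
Definition tens_repr (t : tens) : seq (V * W) :=
  @repr _ {eq_quot tens_equiv} t.

Lemma tens_piP s t : tens_rel s t <-> tens_pi s = tens_pi t.
Proof.
split=> [h|/eqquotP/asboolP //].
by apply/eqquotP/asboolP.
Qed.

Lemma tens_reprK t : tens_pi (tens_repr t) = t.
Proof. exact: reprK. Qed.

Lemma tens_pi_repr s : tens_rel (tens_repr (tens_pi s)) s.
Proof. by apply/tens_piP; rewrite tens_reprK. Qed.

Definition tens_mk (x : V) (y : W) : tens := tens_pi [:: (x, y)].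
Definition tens_zero : tens := tens_pi [::].
Definition tens_add (t u : tens) : tens :=
  tens_pi (tens_repr t ++ tens_repr u).
Definition tens_scale (a : k) (t : tens) : tens :=
  tens_pi [seq (a *: p.1, p.2) | p <- tens_repr t].
Definition tens_opp (t : tens) : tens := tens_scale (- 1) t.

Lemma tens_add_pi s t : tens_add (tens_pi s) (tens_pi t) = tens_pi (s ++ t).
Proof. by apply/tens_piP/TensCat; apply: tens_pi_repr. Qed.

Lemma tens_scale_rel a s t : tens_rel s t ->
  tens_rel [seq (a *: p.1, p.2) | p <- s] [seq (a *: p.1, p.2) | p <- t].
Proof.
elim=> {s t} [s|s t _|s t u _ h _|s s' t t' _ hs _ ht|s t|x x' y|x y y'|b x y|y] /=.
- exact: TensRefl.
- exact: TensSym.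
- exact: TensTrans.
- by rewrite !map_cat; apply: TensCat.
- by rewrite !map_cat; apply: TensCatC.
- by rewrite scalerDr; apply: TensAddl.
- exact: TensAddr.
- by rewrite scalerA mulrC -scalerA; apply: TensScale.
- by rewrite scaler0; apply: TensZero.
Qed.

Lemma tens_scale_pi a s :
  tens_scale a (tens_pi s) = tens_pi [seq (a *: p.1, p.2) | p <- s].
Proof. by apply/tens_piP/tens_scale_rel/tens_pi_repr. Qed.

Lemma tens_piW (P : tens -> Prop) : (forall s, P (tens_pi s)) -> forall t, P t.
Proof. by move=> h t; rewrite -[t]tens_reprK. Qed.

Lemma tens_addA : associative tens_add.
Proof.
elim/tens_piW=> s; elim/tens_piW=> t; elim/tens_piW=> u.
by rewrite !tens_add_pi catA.
Qed.

Lemma tens_addC : commutative tens_add.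
Proof.
elim/tens_piW=> s; elim/tens_piW=> t; rewrite !tens_add_pi.
exact/tens_piP/TensCatC.
Qed.

Lemma tens_add0 : left_id tens_zero tens_add.
Proof. by elim/tens_piW=> s; rewrite tens_add_pi. Qed.

Lemma tens_cons_pi p s : tens_pi (p :: s) = tens_add (tens_mk p.1 p.2) (tens_pi s).
Proof. by case: p => x y; rewrite tens_add_pi. Qed.

Lemma tens_scaleDr a : {morph tens_scale a : t u / tens_add t u}.
Proof.
elim/tens_piW=> s; elim/tens_piW=> t.
by rewrite !(tens_add_pi, tens_scale_pi) map_cat.
Qed.

Lemma tens_scale_mk a x y : tens_scale a (tens_mk x y) = tens_mk (a *: x) y.
Proof. by rewrite tens_scale_pi. Qed.

Lemma tens_mkDl x x' y : tens_mk (x + x') y = tens_add (tens_mk x y) (tens_mk x' y).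
Proof. by rewrite tens_add_pi; apply/tens_piP/TensAddl. Qed.

Lemma tens_scaleDl t a b :
  tens_scale (a + b) t = tens_add (tens_scale a t) (tens_scale b t).
Proof.
elim/tens_piW: t => s; elim: s => [|[x y] s ih].
  by rewrite !tens_scale_pi /= tens_add_pi.
rewrite tens_cons_pi !tens_scaleDr ih !tens_scale_mk /= scalerDl tens_mkDl.
rewrite -!tens_addA; congr tens_add; rewrite !tens_addA; congr tens_add.
exact: tens_addC.
Qed.

Lemma tens_scale1 : left_id 1 tens_scale.
Proof.
elim/tens_piW=> s; rewrite tens_scale_pi; congr tens_pi.
by elim: s => [|[x y] s ih] //=; rewrite scale1r ih.
Qed.

Lemma tens_scaleA a b t : tens_scale a (tens_scale b t) = tens_scale (a * b) t.
Proof.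
elim/tens_piW: t=> s; rewrite !tens_scale_pi; congr tens_pi.
by rewrite -map_comp; apply: eq_map => -[x y] /=; rewrite scalerA.
Qed.

Lemma tens_scale0 t : tens_scale 0 t = tens_zero.
Proof.
elim/tens_piW: t => s; elim: s => [|[x y] s ih]; first by rewrite tens_scale_pi.
rewrite tens_cons_pi tens_scaleDr ih tens_scale_mk scale0r tens_addC tens_add0.
exact/tens_piP/TensZero.
Qed.

Lemma tens_addN : left_inverse tens_zero tens_opp tens_add.
Proof.
by move=> t; rewrite -{2}[t]tens_scale1 -tens_scaleDl addNr tens_scale0.
Qed.

HB.instance Definition _ :=
  GRing.isZmodule.Build tens tens_addA tens_addC tens_add0 tens_addN.

HB.instance Definition _ := GRing.Zmodule_isLmodule.Build k tens
  tens_scaleA tens_scale1 tens_scaleDr tens_scaleDl.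

Local Notation "x \ox y" := (tens_mk x y).

Lemma tmkDl x x' y : (x + x') \ox y = x \ox y + x' \ox y.
Proof. exact: tens_mkDl. Qed.

Lemma tmkDr x y y' : x \ox (y + y') = x \ox y + x \ox y'.
Proof. by rewrite [RHS]tens_add_pi; apply/tens_piP/TensAddr. Qed.

Lemma tmkZl a x y : (a *: x) \ox y = a *: (x \ox y).
Proof. by rewrite [RHS]tens_scale_mk. Qed.

Lemma tmkZr a x y : x \ox (a *: y) = a *: (x \ox y).
Proof. by rewrite -tmkZl; apply/esym/tens_piP/TensScale. Qed.

Lemma tmk0l y : 0 \ox y = 0.
Proof. by rewrite -(scale0r 0) tmkZl scale0r. Qed.

Lemma tmk0r x : x \ox 0 = 0.
Proof. by rewrite -(scale0r 0) tmkZr scale0r. Qed.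

Lemma tens_pi_sum s : tens_pi s = \sum_(p <- s) p.1 \ox p.2.
Proof.
elim: s => [|p s ih]; first by rewrite big_nil.
by rewrite big_cons -ih tens_cons_pi.
Qed.

Lemma tens_indW (P : tens -> Prop) :
  P 0 -> (forall x y t, P t -> P (x \ox y + t)) -> forall t, P t.
Proof.
move=> h0 hD; elim/tens_piW; elim=> [|p s ih]; first exact: h0.
by rewrite tens_cons_pi; apply: hD.
Qed.

Section Lift.
Variable U : lmodType k.

Definition bilin (f : V -> W -> U) : Prop :=
  (forall y, linear (f^~ y)) /\ (forall x, linear (f x)).

(* The linear map induced by a bilinear f (junk if f is not bilinear). *)
Definition tlift (f : V -> W -> U) (t : tens) : U :=
  \sum_(p <- tens_repr t) f p.1 p.2.

Variable f : V -> W -> U.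
Hypothesis fb : bilin f.

Lemma bilinDl x x' y : f (x + x') y = f x y + f x' y.
Proof. by have := fb.1 y 1 x x'; rewrite !scale1r. Qed.
Lemma bilinDr x y y' : f x (y + y') = f x y + f x y'.
Proof. by have := fb.2 x 1 y y'; rewrite !scale1r. Qed.
Lemma bilin0l y : f 0 y = 0.
Proof. by apply: (addrI (f 0 y)); rewrite -bilinDl !addr0. Qed.
Lemma bilin0r x : f x 0 = 0.
Proof. by apply: (addrI (f x 0)); rewrite -bilinDr !addr0. Qed.
Lemma bilinZl a x y : f (a *: x) y = a *: f x y.
Proof. by have := fb.1 y a x 0; rewrite bilin0l !addr0. Qed.
Lemma bilinZr a x y : f x (a *: y) = a *: f x y.
Proof. by have := fb.2 x a y 0; rewrite bilin0r !addr0. Qed.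

Lemma tlift_rel s t : tens_rel s t ->
  \sum_(p <- s) f p.1 p.2 = \sum_(p <- t) f p.1 p.2.
Proof.
elim=> {s t} // [s t u _ -> _ -> //|s s' t t' _ hs _ ht|s t|x x' y|x y y'|a x y|y].
- by rewrite !big_cat /= hs ht.
- by rewrite !big_cat /= addrC.
- by rewrite !big_cons !big_nil /= !addr0 bilinDl.
- by rewrite !big_cons !big_nil /= !addr0 bilinDr.
- by rewrite !big_cons !big_nil /= !addr0 bilinZl bilinZr.
- by rewrite !big_cons !big_nil /= !addr0 bilin0l.
Qed.

Lemma tlift_pi s : tlift f (tens_pi s) = \sum_(p <- s) f p.1 p.2.
Proof. exact/tlift_rel/tens_pi_repr. Qed.

Lemma tliftE x y : tlift f (x \ox y) = f x y.
Proof. by rewrite tlift_pi big_seq1. Qed.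

Lemma tlift_linear : linear (tlift f).
Proof.
move=> a; elim/tens_piW=> s; elim/tens_piW=> t.
rewrite [_ *: _]tens_scale_pi [_ + _]tens_add_pi !tlift_pi big_cat big_map /=.
by rewrite scaler_sumr; congr (_ + _); apply: eq_bigr => p _; rewrite bilinZl.
Qed.

Lemma tlift0 : tlift f 0 = 0.
Proof. by rewrite [0]/(tens_pi [::]) tlift_pi big_nil. Qed.
Lemma tliftD t u : tlift f (t + u) = tlift f t + tlift f u.
Proof. by have := tlift_linear 1 t u; rewrite !scale1r. Qed.

End Lift.

Lemma tens_ext (U : lmodType k) (f g : {linear tens -> U}) :
  (forall x y, f (x \ox y) = g (x \ox y)) -> f =1 g.
Proof.
move=> h; elim/tens_indW=> [|x y t ih]; first by rewrite !linear0.
by rewrite !linearD h ih.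
Qed.

End TensorProduct.

Arguments tens_mk {k V W}.
Notation "x \ox y" := (tens_mk x y) : ring_scope.


(* Enough linear functionals (Zorn), whence x \ox y != 0 for nonzero x, y. *)
Lemma exists_functional (k : fieldType) (V : lmodType k) (v : V) : v != 0 ->
  exists f : V -> k^o, linear f /\ f v = 1.
Proof.
move=> v0.
pose P (S : set V) := (forall a x y, S x -> S y -> S (a *: x + y)) /\ ~ S v.
have [|S [[SL Sv] Smax]] := @Zorn_bigcup V P.
  move=> F FP Ftot; split; last by case=> S FS; case: (FP _ FS).
  move=> a x y [S FS Sx] [T FT Ty].
  have [ST|TS] := Ftot _ _ FS FT.
    by exists T => //; apply: (FP _ FT).1 => //; apply: ST.
  by exists S => //; apply: (FP _ FS).1 => //; apply: TS.
pose S' x := S x \/ x = 0.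
have S'L a x y : S' x -> S' y -> S' (a *: x + y).
  case=> [Sx|->] [Sy|->]; rewrite ?scaler0 ?add0r ?addr0; [|left|by left|by right].
    by left; apply: SL.
  by rewrite -(subrK x (a *: x)) -{2}[x]scale1r -scalerBl; apply: SL.
have S'v : ~ S' v by case=> // v00; rewrite v00 eqxx in v0.
have S'Z a x : S' x -> S' (a *: x).
  by move=> Sx; rewrite -[_ *: _]addr0; apply: S'L => //; right.
have dec x : exists c, S' (x - c *: v).
  have [Sx|Sx] := pselect (S' x); first by exists 0; rewrite scale0r subr0.
  pose T : set V := fun y => exists a s, S' s /\ y = a *: x + s.
  have ST : (S `<` T)%classic.
    split=> [y Sy|TS]; first by exists 0, y; rewrite scale0r add0r; split=> //; left.
    apply: Sx; left; apply: TS; exists 1, 0; rewrite scale1r addr0.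
    by split=> //; right.
  have [a [s [Ss vE]]] : T v.
    have /not_andP[] := Smax _ ST; last by move/contrapT.
    case=> b _ _ [a [s [Ss ->]]] [a' [s' [Ss' ->]]].
    exists (b * a + a'), (b *: s + s'); split; first exact: S'L.
    by rewrite scalerDr scalerA scalerDl addrACA.
  have a0 : a != 0 by apply: contra_notN S'v => /eqP a0; rewrite vE a0 scale0r add0r.
  exists a^-1; rewrite vE scalerDr scalerA mulVf // scale1r opprD addNKr.
  by rewrite -scaleNr; apply: S'Z.
pose f x : k^o := sval (cid (dec x)).
have fP x c : S' (x - c *: v) -> f x = c.
  move=> Sc; rewrite /f; case: cid => c' /= Sc'.
  apply/eqP/negPn/negP => cc'; apply: S'v.
  have : S' ((c' - c)^-1 *: (-1 *: (x - c' *: v) + (x - c *: v))).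
    exact/S'Z/S'L.
  rewrite scaleN1r opprB addrA subrK -scalerBl scalerA mulVf ?scale1r //.
  by rewrite subr_eq0.
exists f; split; last by apply: fP; rewrite scale1r subrr; right.
move=> a x y; apply: fP; rewrite scalerDl opprD addrACA -scalerA -scalerBr.
by apply: S'L; rewrite /f; case: cid.
Qed.

Lemma tmk_neq0 (k : fieldType) (V W : lmodType k) (x : V) (y : W) :
  x != 0 -> y != 0 -> x \ox y != 0.
Proof.
move=> /exists_functional[f [fL fx]] /exists_functional[g [gL gy]].
have fgb : bilin (fun x y => f x *: g y : k^o).
  split=> [y'|x'] a u v /=.
    by rewrite fL scalerDl scalerA.
  by rewrite gL scalerDr scalerA mulrC -scalerA.
apply/eqP => xy0; have := tliftE fgb x y.
rewrite xy0 (tlift0 fgb) fx gy /GRing.scale /= mulr1 => /esym/eqP.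
by rewrite oner_eq0.
Qed.

Section TensorMaps.
Variable k : fieldType.

Section Tmap.
Variables (V V' W W' : lmodType k).
Variables (f : {linear V -> V'}) (g : {linear W -> W'}).

Definition tmap : tens V W -> tens V' W' := tlift (fun x y => f x \ox g y).

Lemma tmap_bilin : bilin (fun x y => f x \ox g y).
Proof.
split=> [y|x] a u v /=; first by rewrite linearP tmkDl tmkZl.
by rewrite linearP tmkDr tmkZr.
Qed.

HB.instance Definition _ :=
  GRing.isLinear.Build k _ _ _ tmap (tlift_linear tmap_bilin).

Lemma tmapE x y : tmap (x \ox y) = f x \ox g y.
Proof. exact: (tliftE tmap_bilin). Qed.
End Tmap.

Section Flip.
Variables (V W : lmodType k).

Definition tflip : tens V W -> tens W V := tlift (fun x y => y \ox x).

Lemma tflip_bilin : bilin (fun (x : V) (y : W) => y \ox x).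
Proof.
by split=> [y|x] a u v /=; rewrite ?(tmkDl, tmkDr) ?(tmkZl, tmkZr).
Qed.

HB.instance Definition _ :=
  GRing.isLinear.Build k _ _ _ tflip (tlift_linear tflip_bilin).

Lemma tflipE x y : tflip (x \ox y) = y \ox x.
Proof. exact: (tliftE tflip_bilin). Qed.
End Flip.

Section MkLinear.
Variables (V W : lmodType k).

Definition tmkl (x : V) : W -> tens V W := fun y => x \ox y.
Definition tmkr (y : W) : V -> tens V W := fun x => x \ox y.

Lemma tmkl_linear x : linear (tmkl x).
Proof. by move=> a u v; rewrite /tmkl tmkDr tmkZr. Qed.
Lemma tmkr_linear y : linear (tmkr y).
Proof. by move=> a u v; rewrite /tmkr tmkDl tmkZl. Qed.

HB.instance Definition _ x :=
  GRing.isLinear.Build k _ _ _ (tmkl x) (tmkl_linear x).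
HB.instance Definition _ y :=
  GRing.isLinear.Build k _ _ _ (tmkr y) (tmkr_linear y).
End MkLinear.
Arguments tmkl {V W}.
Arguments tmkr {V W}.

Section Assoc.
Variables (U V W : lmodType k).

Definition tassoc_aux (s : tens U V) (z : W) : tens U (tens V W) :=
  tmap idfun (tmkr z) s.

Lemma tassoc_bilin : bilin tassoc_aux.
Proof.
split=> [z|s] a u v; first by rewrite /tassoc_aux linearP.
rewrite /tassoc_aux; elim/tens_indW: s => [|x y s ih].
  by rewrite !linear0 ?scaler0 addr0.
have e z : tmap idfun (tmkr z) (x \ox y + s) =
    x \ox (y \ox z) + tmap idfun (tmkr z) s by rewrite linearD /= tmapE.
by rewrite !e ih tmkDr tmkZr tmkDr tmkZr scalerDr addrACA.
Qed.

Definition tassoc : tens (tens U V) W -> tens U (tens V W) := tlift tassoc_aux.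

HB.instance Definition _ :=
  GRing.isLinear.Build k _ _ _ tassoc (tlift_linear tassoc_bilin).

Lemma tassocE x y z : tassoc (x \ox y \ox z) = x \ox (y \ox z).
Proof. by rewrite /tassoc (tliftE tassoc_bilin) /tassoc_aux tmapE. Qed.

Definition tassocV_aux (x : U) (s : tens V W) : tens (tens U V) W :=
  tmap (tmkl x) idfun s.

Lemma tassocV_bilin : bilin tassocV_aux.
Proof.
split=> [s|x] a u v; last by rewrite /tassocV_aux linearP.
rewrite /tassocV_aux; elim/tens_indW: s => [|x y s ih].
  by rewrite !linear0 ?scaler0 addr0.
have e z : tmap (tmkl z) idfun (x \ox y + s) =
    z \ox x \ox y + tmap (tmkl z) idfun s by rewrite linearD /= tmapE.
by rewrite !e ih tmkDl tmkZl tmkDl tmkZl scalerDr addrACA.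
Qed.

Definition tassocV : tens U (tens V W) -> tens (tens U V) W := tlift tassocV_aux.

HB.instance Definition _ :=
  GRing.isLinear.Build k _ _ _ tassocV (tlift_linear tassocV_bilin).

Lemma tassocVE x y z : tassocV (x \ox (y \ox z)) = x \ox y \ox z.
Proof. by rewrite /tassocV (tliftE tassocV_bilin) /tassocV_aux tmapE. Qed.
End Assoc.

Lemma tens_ext3 (U V W X : lmodType k) (f g : {linear tens U (tens V W) -> X}) :
  (forall x y z, f (x \ox (y \ox z)) = g (x \ox (y \ox z))) -> f =1 g.
Proof.
move=> h; apply: tens_ext => x s.
have := tens_ext (f := f \o tmkl x) (g := g \o tmkl x).
by move=> /(_ _ s); apply=> y z; apply: h.
Qed.

Lemma tens_ext3l (U V W X : lmodType k) (f g : {linear tens (tens U V) W -> X}) :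
  (forall x y z, f (x \ox y \ox z) = g (x \ox y \ox z)) -> f =1 g.
Proof.
move=> h; apply: tens_ext => s z.
have := tens_ext (f := f \o tmkr z) (g := g \o tmkr z).
by move=> /(_ _ s); apply=> x y; apply: h.
Qed.

Lemma tassocK (U V W : lmodType k) : cancel (@tassoc U V W) (@tassocV U V W).
Proof.
move=> t; have := tens_ext3l (f := @tassocV U V W \o @tassoc U V W) (g := idfun).
by apply=> x y z /=; rewrite tassocE tassocVE.
Qed.

Lemma tassocVK (U V W : lmodType k) : cancel (@tassocV U V W) (@tassoc U V W).
Proof.
move=> t; have := tens_ext3 (f := @tassoc U V W \o @tassocV U V W) (g := idfun).
by apply=> x y z /=; rewrite tassocVE tassocE.
Qed.

Lemma tflipK (V W : lmodType k) : cancel (@tflip V W) (@tflip W V).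
Proof.
move=> t; have := tens_ext (f := @tflip W V \o @tflip V W) (g := idfun).
by apply=> x y /=; rewrite !tflipE.
Qed.

Section Unit.
Variable V : lmodType k.

Definition tunitl : tens k^o V -> V := tlift (fun (a : k^o) (x : V) => a *: x).

Lemma tunitl_bilin : bilin (fun (a : k^o) (x : V) => a *: x).
Proof.
split=> [x|b] a u v /=; first by rewrite scalerDl scalerA.
by rewrite scalerDr !scalerA mulrC.
Qed.

HB.instance Definition _ :=
  GRing.isLinear.Build k _ _ _ tunitl (tlift_linear tunitl_bilin).

Lemma tunitlE (a : k^o) x : tunitl (a \ox x) = a *: x.
Proof. exact: (tliftE tunitl_bilin). Qed.

Definition tunitr : tens V k^o -> V := tunitl \o @tflip V k^o.
HB.instance Definition _ := GRing.Linear.on tunitr.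

Lemma tunitrE x (a : k^o) : tunitr (x \ox a) = a *: x.
Proof. by rewrite /tunitr /= tflipE tunitlE. Qed.
End Unit.

Section Tact.
Variables (A B V V' W W' : lmodType k).
Variables (f : A -> V -> V') (g : B -> W -> W').
Hypotheses (fb : bilin f) (gb : bilin g).

Definition tact (t : tens A B) (v : tens V W) : tens V' W' :=
  tlift (fun a b => tlift (fun x y => f a x \ox g b y) v) t.

Lemma tact_bilin1 a b : bilin (fun x y => f a x \ox g b y).
Proof.
split=> [y|x] c u v /=; first by rewrite fb.2 tmkDl tmkZl.
by rewrite gb.2 tmkDr tmkZr.
Qed.

Lemma tact_bilin2 v : bilin (fun a b => tlift (fun x y => f a x \ox g b y) v).
Proof.
split=> [b|a] c u u' /=; elim/tens_indW: v => [|x y v ih].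
- by rewrite !(tlift0 (tact_bilin1 _ _)) scaler0 addr0.
- rewrite !(tliftD (tact_bilin1 _ _)) ih !(tliftE (tact_bilin1 _ _)).
  by rewrite fb.1 tmkDl tmkZl scalerDr addrACA.
- by rewrite !(tlift0 (tact_bilin1 _ _)) scaler0 addr0.
- rewrite !(tliftD (tact_bilin1 _ _)) ih !(tliftE (tact_bilin1 _ _)).
  by rewrite gb.1 tmkDr tmkZr scalerDr addrACA.
Qed.

Lemma tactE a b x y : tact (a \ox b) (x \ox y) = f a x \ox g b y.
Proof. by rewrite /tact (tliftE (tact_bilin2 _)) (tliftE (tact_bilin1 _ _)). Qed.

Lemma tact_bilin : bilin tact.
Proof.
split=> [v|t]; first exact: (tlift_linear (tact_bilin2 v)).
move=> c v v'; rewrite /tact; elim/tens_indW: t => [|a b t ih].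
  by rewrite !(tlift0 (tact_bilin2 _)) scaler0 addr0.
rewrite !(tliftD (tact_bilin2 _)) ih !(tliftE (tact_bilin2 _)).
by rewrite (tlift_linear (tact_bilin1 a b)) scalerDr addrACA.
Qed.
End Tact.

End TensorMaps.

Section TensorAlgebra.
Variables (k : fieldType).

Lemma mul_bilin (A : algType k) : bilin (@GRing.mul A).
Proof.
split=> [y|x] a u v /=; first by rewrite mulrDl scalerAl.
by rewrite mulrDr scalerAr.
Qed.

Variables (A B : algType k).

Definition tens_mul : tens A B -> tens A B -> tens A B := tact *%R *%R.
Definition tens_one : tens A B := 1 \ox 1.

Let mb := tact_bilin (mul_bilin A) (mul_bilin B).

Lemma tens_mulE a b a' b' :
  tens_mul (a \ox b) (a' \ox b') = (a * a') \ox (b * b').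
Proof. exact: (tactE (mul_bilin A) (mul_bilin B)). Qed.

Lemma tens_mulDl : left_distributive tens_mul +%R.
Proof. exact: (bilinDl mb). Qed.
Lemma tens_mulDr : right_distributive tens_mul +%R.
Proof. exact: (bilinDr mb). Qed.
Lemma tens_mul0l t : tens_mul 0 t = 0.
Proof. exact: (bilin0l mb). Qed.
Lemma tens_mul0r t : tens_mul t 0 = 0.
Proof. exact: (bilin0r mb). Qed.

Lemma tens_mulA : associative tens_mul.
Proof.
elim/tens_indW=> [|a b s ihs] t u; first by rewrite !tens_mul0l.
rewrite !tens_mulDl ihs; congr (_ + _) => {s ihs}.
elim/tens_indW: t => [|a' b' t iht]; first by rewrite !(tens_mul0l, tens_mul0r).
rewrite !(tens_mulDl, tens_mulDr) iht; congr (_ + _) => {t iht}.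
elim/tens_indW: u => [|a'' b'' u ihu]; first by rewrite !tens_mul0r.
by rewrite !tens_mulDr ihu; congr (_ + _); rewrite !tens_mulE !mulrA.
Qed.

Lemma tens_mul1l : left_id tens_one tens_mul.
Proof.
elim/tens_indW=> [|a b s ihs]; first by rewrite tens_mul0r.
by rewrite tens_mulDr ihs tens_mulE !mul1r.
Qed.

Lemma tens_mul1r : right_id tens_one tens_mul.
Proof.
elim/tens_indW=> [|a b s ihs]; first by rewrite tens_mul0l.
by rewrite tens_mulDl ihs tens_mulE !mulr1.
Qed.

Lemma tens_one_neq0 : tens_one != 0.
Proof. by apply: tmk_neq0; apply: oner_neq0. Qed.

HB.instance Definition _ := GRing.Zmodule_isNzRing.Build (tens A B)
  tens_mulA tens_mul1l tens_mul1r tens_mulDl tens_mulDr tens_one_neq0.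

Lemma tens_scalerAl (a : k) (u v : tens A B) : a *: (u * v) = (a *: u) * v.
Proof. by rewrite [RHS](bilinZl mb). Qed.
Lemma tens_scalerAr (a : k) (u v : tens A B) : a *: (u * v) = u * (a *: v).
Proof. by rewrite [RHS](bilinZr mb). Qed.

HB.instance Definition _ :=
  GRing.Lmodule_isLalgebra.Build k (tens A B) tens_scalerAl.
HB.instance Definition _ :=
  GRing.Lalgebra_isAlgebra.Build k (tens A B) tens_scalerAr.

Lemma tmkM (a a' : A) (b b' : B) :
  (a \ox b) * (a' \ox b') = (a * a') \ox (b * b').
Proof. exact: tens_mulE. Qed.

Lemma tmk1 : 1 \ox 1 = 1 :> tens A B.
Proof. by []. Qed.

End TensorAlgebra.

Section Actions.
Variable k : fieldType.

Record lact (A : algType k) (V : lmodType k) := LAct {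
  lact_fun :> A -> V -> V;
  lact_bilin : bilin lact_fun;
  lactM : forall a b v, lact_fun (a * b) v = lact_fun a (lact_fun b v);
  lact1 : forall v, lact_fun 1 v = v }.

Arguments lact_fun : simpl never.

Section Basics.
Variables (A : algType k) (V : lmodType k) (rho : lact A V).
Lemma lactDl a b v : rho (a + b) v = rho a v + rho b v.
Proof. exact: (bilinDl (lact_bilin rho)). Qed.
Lemma lactDr a u v : rho a (u + v) = rho a u + rho a v.
Proof. exact: (bilinDr (lact_bilin rho)). Qed.
Lemma lact0l v : rho 0 v = 0.
Proof. exact: (bilin0l (lact_bilin rho)). Qed.
Lemma lact0r a : rho a 0 = 0.
Proof. exact: (bilin0r (lact_bilin rho)). Qed.
Lemma lactZl c a v : rho (c *: a) v = c *: rho a v.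
Proof. exact: (bilinZl (lact_bilin rho)). Qed.
Lemma lactZr c a v : rho a (c *: v) = c *: rho a v.
Proof. exact: (bilinZr (lact_bilin rho)). Qed.
End Basics.

Section Regular.
Variable A : algType k.
Definition lact_reg : lact A A :=
  @LAct A A *%R (mul_bilin A) (fun a b v => esym (mulrA a b v)) (@mul1r A).
End Regular.

Section Pull.
Variables (A B : algType k) (V : lmodType k).
Variables (f : {lrmorphism A -> B}) (rho : lact B V).

Lemma pull_bilin : bilin (fun a v => rho (f a) v).
Proof.
split=> [v|a] c x y /=; first by rewrite linearP lactDl lactZl.
by rewrite lactDr lactZr.
Qed.
Lemma pullM a b v : rho (f (a * b)) v = rho (f a) (rho (f b) v).
Proof. by rewrite rmorphM lactM. Qed.
Lemma pull1 v : rho (f 1) v = v.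
Proof. by rewrite rmorph1 lact1. Qed.

Definition lact_pull : lact A V := LAct pull_bilin pullM pull1.
End Pull.

Section TensorAction.
Variables (A B : algType k) (V W : lmodType k) (rho : lact A V) (sig : lact B W).

Let tb := tact_bilin (lact_bilin rho) (lact_bilin sig).

Lemma tact_mul s t v : tact rho sig (s * t) v = tact rho sig s (tact rho sig t v).
Proof.
elim/tens_indW: s => [|a b s ihs].
  by rewrite mul0r !(bilin0l tb).
rewrite mulrDl !(bilinDl tb) ihs; congr (_ + _) => {s ihs}.
elim/tens_indW: t => [|a' b' t iht].
  by rewrite mulr0 !(bilin0l tb) (bilin0r tb).
rewrite mulrDr !(bilinDl tb) (bilinDr tb) iht; congr (_ + _) => {t iht}.
elim/tens_indW: v => [|x y v ihv]; first by rewrite !(bilin0r tb).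
rewrite !(bilinDr tb) ihv; congr (_ + _).
rewrite tmkM !(tactE (lact_bilin rho) (lact_bilin sig)).
by rewrite !lactM.
Qed.

Lemma tact_one v : tact rho sig 1 v = v.
Proof.
elim/tens_indW: v => [|x y v ihv]; first by rewrite (bilin0r tb).
rewrite (bilinDr tb) ihv -tmk1 (tactE (lact_bilin rho) (lact_bilin sig)).
by rewrite !lact1.
Qed.

Definition lact_tens : lact (tens A B) (tens V W) := LAct tb tact_mul tact_one.

Lemma lact_tensE a b x y : lact_tens (a \ox b) (x \ox y) = rho a x \ox sig b y.
Proof. exact: (tactE (lact_bilin rho) (lact_bilin sig)). Qed.
End TensorAction.

Lemma lact_tens_map (A A' B B' : algType k) (V V' W W' : lmodType k)
  (rho : lact A V) (rho' : lact A' V') (sig : lact B W) (sig' : lact B' W')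
  (p : {linear A -> A'}) (q : {linear B -> B'})
  (f : {linear V -> V'}) (g : {linear W -> W'}) :
  (forall a x, f (rho a x) = rho' (p a) (f x)) ->
  (forall b y, g (sig b y) = sig' (q b) (g y)) ->
  forall t v, tmap f g (lact_tens rho sig t v) =
    lact_tens rho' sig' (tmap p q t) (tmap f g v).
Proof.
move=> hf hg t v; elim/tens_indW: t => [|a b t iht].
  by rewrite !(lact0l, linear0).
rewrite linearD /= !lactDl linearD /= iht; congr (_ + _) => {t iht}.
elim/tens_indW: v => [|x y v ihv]; first by rewrite !(lact0r, linear0).
rewrite linearD /= !lactDr linearD /= ihv; congr (_ + _).
by rewrite lact_tensE !tmapE lact_tensE hf hg.
Qed.

Lemma lact_tens_pull (A A' B B' : algType k) (V W : lmodType k)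
  (rho : lact A V) (rho' : lact A' V) (sig : lact B W) (sig' : lact B' W)
  (p : {linear A -> A'}) (q : {linear B -> B'}) :
  (forall a x, rho a x = rho' (p a) x) ->
  (forall b y, sig b y = sig' (q b) y) ->
  forall t v, lact_tens rho sig t v = lact_tens rho' sig' (tmap p q t) v.
Proof.
move=> hf hg t v.
elim/tens_indW: t => [|a b t iht]; first by rewrite linear0 !lact0l.
rewrite linearD /= !lactDl iht; congr (_ + _) => {t iht}.
elim/tens_indW: v => [|x y v ihv]; first by rewrite !lact0r.
by rewrite !lactDr ihv; congr (_ + _); rewrite tmapE !lact_tensE hf hg.
Qed.

Lemma lact_tens_flip (A B : algType k) (V W : lmodType k)
  (rho : lact A V) (sig : lact B W) t v :
  tflip (lact_tens rho sig t v) = lact_tens sig rho (tflip t) (tflip v).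
Proof.
elim/tens_indW: t => [|a b t iht]; first by rewrite !(lact0l, linear0).
rewrite linearD /= !lactDl linearD /= iht; congr (_ + _) => {t iht}.
elim/tens_indW: v => [|x y v ihv]; first by rewrite !(lact0r, linear0).
rewrite linearD /= !lactDr linearD /= ihv; congr (_ + _).
by rewrite lact_tensE !tflipE lact_tensE.
Qed.

Lemma lact_tens_assoc (A B C : algType k) (U V W : lmodType k)
  (rho : lact A U) (sig : lact B V) (tau : lact C W) t v :
  tassoc (lact_tens (lact_tens rho sig) tau t v) =
  lact_tens rho (lact_tens sig tau) (tassoc t) (tassoc v).
Proof.
elim/tens_indW: t => [|s c t iht]; first by rewrite !(lact0l, linear0).
rewrite linearD /= !lactDl linearD /= iht; congr (_ + _) => {t iht}.
elim/tens_indW: v => [|w z v ihv]; first by rewrite !(lact0r, linear0).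
rewrite linearD /= !lactDr linearD /= ihv; congr (_ + _) => {v ihv}.
elim/tens_indW: s => [|a b s ihs].
  by rewrite tmk0l !(lact0l, linear0).
rewrite tmkDl linearD /= !lactDl linearD /= ihs; congr (_ + _) => {s ihs}.
elim/tens_indW: w => [|x y w ihw].
  by rewrite tmk0l !(lact0r, linear0).
rewrite tmkDl linearD /= !lactDr linearD /= ihw; congr (_ + _).
by rewrite !(lact_tensE, tassocE).
Qed.

Lemma lact_tens_assocV (A B C : algType k) (U V W : lmodType k)
  (rho : lact A U) (sig : lact B V) (tau : lact C W) t v :
  tassocV (lact_tens rho (lact_tens sig tau) t v) =
  lact_tens (lact_tens rho sig) tau (tassocV t) (tassocV v).
Proof.
by apply: (can_inj (@tassocK _ _ _ _)); rewrite lact_tens_assoc !tassocVK.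
Qed.

End Actions.
Arguments lact_fun : simpl never.

Section TensorMultiplicative.
Variable k : fieldType.
Variables (A B C : algType k).

Lemma tflipM : {morph @tflip k A B : s t / s * t}.
Proof. by move=> s t; apply: (lact_tens_flip (lact_reg A) (lact_reg B)). Qed.

Lemma tassocM : {morph @tassoc k A B C : s t / s * t}.
Proof.
by move=> s t; apply: (lact_tens_assoc (lact_reg A) (lact_reg B) (lact_reg C)).
Qed.

Lemma tassocVM : {morph @tassocV k A B C : s t / s * t}.
Proof.
by move=> s t; apply: (lact_tens_assocV (lact_reg A) (lact_reg B) (lact_reg C)).
Qed.

Lemma tmapM (A' B' : algType k) (f : {lrmorphism A -> A'})
    (g : {lrmorphism B -> B'}) : {morph tmap f g : s t / s * t}.
Proof.
move=> s t.
by apply: (lact_tens_map (rho := lact_reg A) (rho' := lact_reg A')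
  (sig := lact_reg B) (sig' := lact_reg B')) => ? ?; apply: rmorphM.
Qed.
End TensorMultiplicative.

Section QuasiBialgebra.
Variables (k : fieldType) (H : algType k).

Local Notation H2 := (tens H H).
Local Notation H3 := (tens H (tens H H)).

(* The triple tensor power is bracketed to the right; tassoc moves elements of
   (H (x) H) (x) H into it. *)
Definition leg12 (t : H2) : H3 := tassoc (t \ox 1).
Definition leg23 (t : H2) : H3 := 1 \ox t.
Definition leg13 (t : H2) : H3 := tmap idfun (tmkl 1) t.

(* perm_ijk (x1 (x) x2 (x) x3) = x_i (x) x_j (x) x_k. *)
Definition perm132 (t : H3) : H3 := tmap idfun (@tflip k H H) t.
Definition perm213 (t : H3) : H3 := tassoc (tmap (@tflip k H H) idfun (tassocV t)).
Definition perm231 (t : H3) : H3 := tassoc (tflip t).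
Definition perm312 (t : H3) : H3 := tflip (tassocV t).

Lemma leg12E x y : leg12 (x \ox y) = x \ox (y \ox 1).
Proof. exact: tassocE. Qed.
Lemma leg13E x y : leg13 (x \ox y) = x \ox (1 \ox y).
Proof. exact: tmapE. Qed.
Lemma perm132E x y z : perm132 (x \ox (y \ox z)) = x \ox (z \ox y).
Proof. by rewrite /perm132 tmapE /= tflipE. Qed.
Lemma perm213E x y z : perm213 (x \ox (y \ox z)) = y \ox (x \ox z).
Proof. by rewrite /perm213 tassocVE tmapE /= tflipE tassocE. Qed.
Lemma perm231E x y z : perm231 (x \ox (y \ox z)) = y \ox (z \ox x).
Proof. by rewrite /perm231 tflipE tassocE. Qed.
Lemma perm312E x y z : perm312 (x \ox (y \ox z)) = z \ox (x \ox y).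
Proof. by rewrite /perm312 tassocVE tflipE. Qed.

(* The inverses of Phi, l, r (and of R below) are data; being two-sided, they are unique. *)
Record quasi_bialgebra := QuasiBialgebra {
  Delta : {lrmorphism H -> H2};
  eps : {lrmorphism H -> k^o};
  Phi : H3;
  PhiV : H3;
  ell : H;
  ellV : H;
  arr : H; (* the element r *)
  arrV : H;
  Phi_mulV : Phi * PhiV = 1;
  PhiV_mul : PhiV * Phi = 1;
  ell_mulV : ell * ellV = 1;
  ellV_mul : ellV * ell = 1;
  arr_mulV : arr * arrV = 1;
  arrV_mul : arrV * arr = 1;
  Delta_coassoc : forall h,
    tmap idfun Delta (Delta h) = Phi * tassoc (tmap Delta idfun (Delta h)) * PhiV;
  Delta_counitl : forall h, tunitl (tmap eps idfun (Delta h)) = ellV * h * ell;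
  Delta_counitr : forall h, tunitr (tmap idfun eps (Delta h)) = arrV * h * arr;
  (* Equation in H (x) (H (x) (H (x) H)). *)
  Phi_pentagon :
    tmap idfun (tmap idfun Delta) Phi * tassoc (tmap Delta idfun Phi) =
    (1 \ox Phi)
    * tmap idfun (@tassoc k H H H) (tmap idfun (tmap Delta idfun) Phi)
    * tmap idfun (@tassoc k H H H) (tassoc (Phi \ox 1));
  Phi_triangle :
    tmap idfun (@tunitl k H) (tmap idfun (tmap eps idfun) Phi) = arr \ox ellV
}.

Record quasitriangular := Quasitriangular {
  qbialg :> quasi_bialgebra;
  Rmat : H2;
  RmatV : H2;
  Rmat_mulV : Rmat * RmatV = 1;
  RmatV_mul : RmatV * Rmat = 1;
  Rmat_cocomm : forall h,
    tflip (Delta qbialg h) = Rmat * Delta qbialg h * RmatV;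
  Rmat_idDelta :
    tmap idfun (Delta qbialg) Rmat =
    perm312 (PhiV qbialg) * leg13 Rmat * perm213 (Phi qbialg) * leg12 Rmat
    * PhiV qbialg;
  Rmat_Deltaid :
    tassoc (tmap (Delta qbialg) idfun Rmat) =
    perm231 (Phi qbialg) * leg13 Rmat * perm132 (PhiV qbialg) * leg23 Rmat
    * Phi qbialg
}.

Definition is_inf_Rmatrix (Q : quasitriangular) (chi : H2) : Prop :=
  [/\ forall h, chi * Delta Q h = Delta Q h * chi,
      tmap idfun (Delta Q) chi =
        Phi Q * leg12 (RmatV Q) * perm213 (PhiV Q) * leg13 chi
          * perm213 (Phi Q) * leg12 (Rmat Q) * PhiV Q
        + Phi Q * leg12 chi * PhiV Q
    & tassoc (tmap (Delta Q) idfun chi) =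
        PhiV Q * leg23 (RmatV Q) * perm132 (Phi Q) * leg13 chi
          * perm132 (PhiV Q) * leg23 (Rmat Q) * Phi Q
        + PhiV Q * leg23 chi * Phi Q].

Definition inf_Rmatrix (Q : quasitriangular) : Type :=
  {chi : H2 | is_inf_Rmatrix Q chi}.

End QuasiBialgebra.

Reserved Notation "g \oc f" (at level 40, left associativity).

Record preadditive := Preadditive {
  obj :> Type;
  hom : obj -> obj -> zmodType;
  idm : forall X, hom X X;
  ccomp : forall X Y Z, hom Y Z -> hom X Y -> hom X Z;
  ccompA : forall X Y Z W (h : hom Z W) (g : hom Y Z) (f : hom X Y),
    ccomp h (ccomp g f) = ccomp (ccomp h g) f;
  ccomp1m : forall X Y (f : hom X Y), ccomp (idm Y) f = f;
  ccompm1 : forall X Y (f : hom X Y), ccomp f (idm X) = f;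
  ccompDl : forall X Y Z (g g' : hom Y Z) (f : hom X Y),
    ccomp (g + g') f = ccomp g f + ccomp g' f;
  ccompDr : forall X Y Z (g : hom Y Z) (f f' : hom X Y),
    ccomp g (f + f') = ccomp g f + ccomp g f'
}.
Arguments idm {p} X.
Notation "g \oc f" := (ccomp g f).

Record monoidal := Monoidal {
  mcat :> preadditive;
  tob : mcat -> mcat -> mcat;
  tmor : forall X X' Y Y' : mcat,
    hom X X' -> hom Y Y' -> hom (tob X Y) (tob X' Y');
  munit : mcat;
  asc : forall X Y Z : mcat, hom (tob (tob X Y) Z) (tob X (tob Y Z));
  ascV : forall X Y Z : mcat, hom (tob X (tob Y Z)) (tob (tob X Y) Z);
  lun : forall X : mcat, hom (tob munit X) X;
  lunV : forall X : mcat, hom X (tob munit X);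
  run : forall X : mcat, hom (tob X munit) X;
  runV : forall X : mcat, hom X (tob X munit);
  tmor1 : forall X Y : mcat, tmor (idm X) (idm Y) = idm (tob X Y);
  tmor_comp : forall (X X' X'' Y Y' Y'' : mcat) (f' : hom X' X'')
    (f : hom X X') (g' : hom Y' Y'') (g : hom Y Y'),
    tmor (f' \oc f) (g' \oc g) = tmor f' g' \oc tmor f g;
  asc_nat : forall (X X' Y Y' Z Z' : mcat)
    (f : hom X X') (g : hom Y Y') (h : hom Z Z'),
    asc X' Y' Z' \oc tmor (tmor f g) h = tmor f (tmor g h) \oc asc X Y Z;
  asc_ascV : forall X Y Z : mcat, asc X Y Z \oc ascV X Y Z = idm _;
  ascV_asc : forall X Y Z : mcat, ascV X Y Z \oc asc X Y Z = idm _;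
  lun_nat : forall (X X' : mcat) (f : hom X X'),
    lun X' \oc tmor (idm munit) f = f \oc lun X;
  lun_lunV : forall X : mcat, lun X \oc lunV X = idm _;
  lunV_lun : forall X : mcat, lunV X \oc lun X = idm _;
  run_nat : forall (X X' : mcat) (f : hom X X'),
    run X' \oc tmor f (idm munit) = f \oc run X;
  run_runV : forall X : mcat, run X \oc runV X = idm _;
  runV_run : forall X : mcat, runV X \oc run X = idm _;
  asc_pentagon : forall W X Y Z : mcat,
    tmor (idm W) (asc X Y Z) \oc asc W (tob X Y) Z \oc tmor (asc W X Y) (idm Z)
    = asc W X (tob Y Z) \oc asc (tob W X) Y Z;
  asc_triangle : forall X Y : mcat,
    tmor (idm X) (lun Y) \oc asc X munit Y = tmor (run X) (idm Y)
}.
Arguments tob {m} X Y.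

Record braided := Braided {
  bcat :> monoidal;
  brd : forall X Y : bcat, hom (tob X Y) (tob Y X);
  brdV : forall X Y : bcat, hom (tob Y X) (tob X Y);
  brd_nat : forall (X X' Y Y' : bcat) (f : hom X X') (g : hom Y Y'),
    brd X' Y' \oc tmor f g = tmor g f \oc brd X Y;
  brd_brdV : forall X Y : bcat, brd X Y \oc brdV X Y = idm _;
  brdV_brd : forall X Y : bcat, brdV X Y \oc brd X Y = idm _;
  brd_hexagon1 : forall X Y Z : bcat,
    asc Y Z X \oc brd X (tob Y Z) \oc asc X Y Z =
    tmor (idm Y) (brd X Z) \oc asc Y X Z \oc tmor (brd X Y) (idm Z);
  brd_hexagon2 : forall X Y Z : bcat,
    ascV Z X Y \oc brd (tob X Y) Z \oc ascV X Y Z =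
    tmor (brd X Z) (idm Y) \oc ascV X Z Y \oc tmor (idm X) (brd Y Z)
}.

Record inf_braiding (C : braided) := InfBraiding {
  ibr :> forall X Y : C, hom (tob X Y) (tob X Y);
  ibr_nat : forall (X X' Y Y' : C) (f : hom X X') (g : hom Y Y'),
    ibr X' Y' \oc tmor f g = tmor f g \oc ibr X Y;
  ibr_tensr : forall X Y Z : C,
    ibr X (tob Y Z) =
    asc X Y Z \oc tmor (ibr X Y) (idm Z) \oc ascV X Y Z
    + asc X Y Z \oc tmor (brdV X Y) (idm Z) \oc ascV Y X Z
      \oc tmor (idm Y) (ibr X Z)
      \oc asc Y X Z \oc tmor (brd X Y) (idm Z) \oc ascV X Y Z;
  ibr_tensl : forall X Y Z : C,
    ibr (tob X Y) Z =
    ascV X Y Z \oc tmor (idm X) (ibr Y Z) \oc asc X Y Z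
    + ascV X Y Z \oc tmor (idm X) (brdV Y Z) \oc asc X Z Y
      \oc tmor (ibr X Z) (idm Y)
      \oc ascV X Z Y \oc tmor (idm X) (brd Y Z) \oc asc X Y Z
}.

Section HModules.
Variables (k : fieldType) (H : algType k).

(* A left H-module is a k-vector space with an action that is k-bilinear; its
   k-structure is thus the one induced by k -> H. *)
Record hmod := HMod { hcar :> lmodType k; hact : lact H hcar }.

Definition hmod_reg : hmod := HMod (lact_reg H).

Section Hom.
Variables X Y : hmod.

Record hhom := HHom {
  hfun :> X -> Y;
  hfun_linear : linear hfun;
  hfunP : forall h x, hfun (hact X h x) = hact Y h (hfun x)
}.

HB.instance Definition _ (f : hhom) :=
  GRing.isLinear.Build k X Y _ (hfun f) (hfun_linear f).

Lemma hhom_ext (f g : hhom) : (f =1 g) -> f = g.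
Proof.
case: f g => [f fL fP] [g gL gP] /= /funext fg; rewrite -{}fg in gL gP *.
by congr HHom; apply: Prop_irrelevance.
Qed.

HB.instance Definition _ := gen_eqMixin hhom.
HB.instance Definition _ := gen_choiceMixin hhom.

Lemma hzero_linear : linear (fun _ : X => 0 : Y).
Proof. by move=> a x y; rewrite scaler0 addr0. Qed.
Lemma hzeroP h (x : X) : (fun _ : X => 0 : Y) (hact X h x) = hact Y h 0.
Proof. by rewrite lact0r. Qed.
Definition hzero : hhom := HHom hzero_linear hzeroP.

Lemma hopp_linear (f : hhom) : linear (fun x => - f x).
Proof. by move=> a x y; rewrite linearP opprD scalerN. Qed.
Lemma hoppP (f : hhom) h x : - f (hact X h x) = hact Y h (- f x).
Proof. by rewrite hfunP -!scaleN1r lactZr. Qed.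
Definition hopp (f : hhom) : hhom := HHom (hopp_linear f) (hoppP f).

Lemma hadd_linear (f g : hhom) : linear (fun x => f x + g x).
Proof. by move=> a x y; rewrite !linearP scalerDr addrACA. Qed.
Lemma haddP (f g : hhom) h x :
  f (hact X h x) + g (hact X h x) = hact Y h (f x + g x).
Proof. by rewrite !hfunP lactDr. Qed.
Definition hadd (f g : hhom) : hhom := HHom (hadd_linear f g) (haddP f g).

Lemma haddA : associative hadd.
Proof. by move=> f g h; apply: hhom_ext => x /=; rewrite addrA. Qed.
Lemma haddC : commutative hadd.
Proof. by move=> f g; apply: hhom_ext => x /=; rewrite addrC. Qed.
Lemma hadd0 : left_id hzero hadd.
Proof. by move=> f; apply: hhom_ext => x /=; rewrite add0r. Qed.
Lemma haddN : left_inverse hzero hopp hadd.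
Proof. by move=> f; apply: hhom_ext => x /=; rewrite addNr. Qed.

HB.instance Definition _ := GRing.isZmodule.Build hhom haddA haddC hadd0 haddN.
End Hom.

Lemma hid_linear (X : hmod) : linear (idfun : X -> X).
Proof. by []. Qed.
Definition hid (X : hmod) : hhom X X :=
  HHom (@hid_linear X) (fun _ _ => erefl).

Section Comp.
Variables (X Y Z : hmod) (g : hhom Y Z) (f : hhom X Y).
Lemma hcomp_linear : linear (fun x => g (f x)).
Proof. by move=> a x y; rewrite !linearP. Qed.
Lemma hcompP h x : g (f (hact X h x)) = hact Z h (g (f x)).
Proof. by rewrite !hfunP. Qed.
Definition hcomp : hhom X Z := HHom hcomp_linear hcompP.
End Comp.

Lemma hcompA (X Y Z W : hmod) (h : hhom Z W) (g : hhom Y Z) (f : hhom X Y) :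
  hcomp h (hcomp g f) = hcomp (hcomp h g) f.
Proof. exact: hhom_ext. Qed.
Lemma hcomp1m (X Y : hmod) (f : hhom X Y) : hcomp (hid Y) f = f.
Proof. exact: hhom_ext. Qed.
Lemma hcompm1 (X Y : hmod) (f : hhom X Y) : hcomp f (hid X) = f.
Proof. exact: hhom_ext. Qed.
Lemma hcompDl (X Y Z : hmod) (g g' : hhom Y Z) (f : hhom X Y) :
  hcomp (g + g') f = hcomp g f + hcomp g' f.
Proof. exact: hhom_ext. Qed.
Lemma hcompDr (X Y Z : hmod) (g : hhom Y Z) (f f' : hhom X Y) :
  hcomp g (f + f') = hcomp g f + hcomp g f'.
Proof. by apply: hhom_ext => x; apply: linearD. Qed.

Definition hmod_preadditive : preadditive :=
  @Preadditive hmod hhom hid hcomp hcompA hcomp1m hcompm1 hcompDl hcompDr.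

Variable Q : quasitriangular H.

Let D := Delta Q.

Definition htens (X Y : hmod) : hmod :=
  HMod (lact_pull D (lact_tens (hact X) (hact Y))).

Definition hunit : hmod := HMod (lact_pull (eps Q) (lact_reg k^o)).

Definition act2 (X Y : hmod) : lact (tens H H) (tens X Y) :=
  lact_tens (hact X) (hact Y).
Definition act3 (X Y Z : hmod) : lact (tens H (tens H H)) (tens X (tens Y Z)) :=
  lact_tens (hact X) (act2 Y Z).

Lemma hact_htens X Y h v : hact (htens X Y) h v = act2 X Y (D h) v.
Proof. by []. Qed.

Section TensorHom.
Variables (X X' Y Y' : hmod) (f : hhom X X') (g : hhom Y Y').
Lemma act2_map t v : tmap f g (act2 X Y t v) = act2 X' Y' t (tmap f g v).
Proof.
have := lact_tens_map (p := idfun) (q := idfun) (hfunP f) (hfunP g) t v.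
suff -> : tmap idfun idfun t = t by [].
by have := tens_ext (f := tmap idfun idfun) (g := idfun) _ t; apply=> a b /=; rewrite tmapE.
Qed.
Definition htmor_fun (v : htens X Y) : htens X' Y' := tmap f g v.
Lemma htmor_linear : linear htmor_fun.
Proof. exact: (linearP (tmap f g)). Qed.
Lemma htmorP h v :
  htmor_fun (hact (htens X Y) h v) = hact (htens X' Y') h (htmor_fun v).
Proof. exact: act2_map. Qed.
Definition htmor : hhom (htens X Y) (htens X' Y') := HHom htmor_linear htmorP.
End TensorHom.

Lemma tmap_act (A B : algType k) (V V' W W' : lmodType k)
  (mu : lact A V') (nu : lact B W') (f f' : {linear V -> V'})
  (g g' : {linear W -> W'}) a b :
  (forall x, f' x = mu a (f x)) -> (forall y, g' y = nu b (g y)) ->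
  forall v, tmap f' g' v = lact_tens mu nu (a \ox b) (tmap f g v).
Proof.
move=> hf hg v; elim/tens_indW: v => [|x y v ih].
  by rewrite !linear0 lact0r.
by rewrite linearD [in RHS]linearD /= lactDr ih !tmapE lact_tensE hf hg.
Qed.

Lemma act2_htensl (X Y Z : hmod) t v :
  tassoc (act2 (htens X Y) Z t v) =
  act3 X Y Z (tassoc (tmap D idfun t)) (tassoc v).
Proof.
rewrite -lact_tens_assoc; congr tassoc.
exact: (lact_tens_pull (rho' := act2 X Y) (sig' := hact Z) (p := D) (q := idfun)).
Qed.

Lemma act2_htensr (X Y Z : hmod) t v :
  act2 X (htens Y Z) t v = act3 X Y Z (tmap idfun D t) v.
Proof.
exact: (lact_tens_pull (rho' := hact X) (sig' := act2 Y Z) (p := idfun) (q := D)).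
Qed.

Lemma Delta_Phi h :
  Phi Q * tassoc (tmap D idfun (D h)) = tmap idfun D (D h) * Phi Q.
Proof. by rewrite Delta_coassoc -mulrA PhiV_mul mulr1. Qed.

Lemma PhiV_Delta h :
  tassoc (tmap D idfun (D h)) * PhiV Q = PhiV Q * tmap idfun D (D h).
Proof. by rewrite Delta_coassoc !mulrA PhiV_mul mul1r. Qed.

Section Assoc.
Variables X Y Z : hmod.

Definition hasc_fun (v : htens (htens X Y) Z) : htens X (htens Y Z) :=
  act3 X Y Z (Phi Q) (tassoc v).
Lemma hasc_linear : linear hasc_fun.
Proof. by move=> a u v; rewrite /hasc_fun linearP lactDr lactZr. Qed.
Lemma hascP h v :
  hasc_fun (hact (htens (htens X Y) Z) h v) =
  hact (htens X (htens Y Z)) h (hasc_fun v).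
Proof.
rewrite /hasc_fun !hact_htens.
by rewrite act2_htensl act2_htensr -!lactM Delta_Phi.
Qed.
Definition hasc : hhom (htens (htens X Y) Z) (htens X (htens Y Z)) :=
  HHom hasc_linear hascP.

Definition hascV_fun (v : htens X (htens Y Z)) : htens (htens X Y) Z :=
  tassocV (act3 X Y Z (PhiV Q) v).
Lemma hascV_linear : linear hascV_fun.
Proof. by move=> a u v; rewrite /hascV_fun lactDr lactZr linearP. Qed.
Lemma hascVP h v :
  hascV_fun (hact (htens X (htens Y Z)) h v) =
  hact (htens (htens X Y) Z) h (hascV_fun v).
Proof.
apply: (can_inj (@tassocK _ _ _ _)).
rewrite !hact_htens act2_htensl /hascV_fun !tassocVK.
by rewrite act2_htensr -!lactM PhiV_Delta.
Qed.
Definition hascV : hhom (htens X (htens Y Z)) (htens (htens X Y) Z) :=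
  HHom hascV_linear hascVP.
End Assoc.

Section Unitors.
Variable X : hmod.

Lemma tunitl_act t v :
  tunitl (lact_tens (lact_reg k^o) (hact X) t v) = hact X (tunitl t) (tunitl v).
Proof.
elim/tens_indW: t => [|a b t iht]; first by rewrite !(lact0l, linear0).
rewrite linearD /= !lactDl linearD /= iht; congr (_ + _) => {t iht}.
elim/tens_indW: v => [|x y v ihv]; first by rewrite !(lact0r, linear0).
rewrite linearD /= !lactDr linearD /= ihv; congr (_ + _).
by rewrite lact_tensE !tunitlE lactZl lactZr scalerA.
Qed.

Lemma tunitr_act t v :
  tunitr (lact_tens (hact X) (lact_reg k^o) t v) = hact X (tunitr t) (tunitr v).
Proof. by rewrite /tunitr /= lact_tens_flip tunitl_act. Qed.

Lemma tunitl_eps t v :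
  tunitl (act2 hunit X t v) = hact X (tunitl (tmap (eps Q) idfun t)) (tunitl v).
Proof.
rewrite -tunitl_act; congr tunitl.
exact: (lact_tens_pull (rho' := lact_reg k^o) (sig' := hact X)
          (p := eps Q) (q := idfun)).
Qed.

Lemma tunitr_eps t v :
  tunitr (act2 X hunit t v) = hact X (tunitr (tmap idfun (eps Q) t)) (tunitr v).
Proof.
rewrite -tunitr_act; congr tunitr.
exact: (lact_tens_pull (rho' := hact X) (sig' := lact_reg k^o)
          (p := idfun) (q := eps Q)).
Qed.

Definition hlun_fun (v : htens hunit X) : X := hact X (ell Q) (tunitl v).
Lemma hlun_linear : linear hlun_fun.
Proof. by move=> a u v; rewrite /hlun_fun linearP lactDr lactZr. Qed.
Lemma hlunP h v : hlun_fun (hact (htens hunit X) h v) = hact X h (hlun_fun v).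
Proof.
rewrite /hlun_fun hact_htens tunitl_eps -!lactM.
by rewrite Delta_counitl !mulrA ell_mulV mul1r.
Qed.
Definition hlun : hhom (htens hunit X) X := HHom hlun_linear hlunP.

Definition hlunV_fun (x : X) : htens hunit X := (1 : k^o) \ox hact X (ellV Q) x.
Lemma hlunV_linear : linear hlunV_fun.
Proof. by move=> a u v; rewrite /hlunV_fun lactDr lactZr tmkDr tmkZr. Qed.

Lemma hlunK : cancel hlun_fun hlunV_fun.
Proof.
move=> v; rewrite /hlun_fun /hlunV_fun -lactM ellV_mul lact1.
have := tens_ext (f := tmkl (1 : k^o) \o @tunitl k X) (g := idfun) _ v.
by apply=> a x /=; rewrite tunitlE /tmkl tmkZr -tmkZl /GRing.scale /= mulr1.
Qed.
Lemma hlunVK : cancel hlunV_fun hlun_fun.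
Proof.
by move=> x; rewrite /hlun_fun /hlunV_fun tunitlE scale1r -lactM ell_mulV lact1.
Qed.
Lemma hlunVP h x : hlunV_fun (hact X h x) = hact (htens hunit X) h (hlunV_fun x).
Proof. by apply: (can_inj hlunK); rewrite hlunP !hlunVK. Qed.
Definition hlunV : hhom X (htens hunit X) := HHom hlunV_linear hlunVP.

Definition hrun_fun (v : htens X hunit) : X := hact X (arr Q) (tunitr v).
Lemma hrun_linear : linear hrun_fun.
Proof. by move=> a u v; rewrite /hrun_fun linearP lactDr lactZr. Qed.
Lemma hrunP h v : hrun_fun (hact (htens X hunit) h v) = hact X h (hrun_fun v).
Proof.
rewrite /hrun_fun hact_htens tunitr_eps -!lactM.
by rewrite Delta_counitr !mulrA arr_mulV mul1r.
Qed.
Definition hrun : hhom (htens X hunit) X := HHom hrun_linear hrunP.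

Definition hrunV_fun (x : X) : htens X hunit := hact X (arrV Q) x \ox (1 : k^o).
Lemma hrunV_linear : linear hrunV_fun.
Proof. by move=> a u v; rewrite /hrunV_fun lactDr lactZr tmkDl tmkZl. Qed.

Lemma hrunK : cancel hrun_fun hrunV_fun.
Proof.
move=> v; rewrite /hrun_fun /hrunV_fun -lactM arrV_mul lact1.
have := tens_ext (f := tmkr (1 : k^o) \o @tunitr k X) (g := idfun) _ v.
by apply=> x a /=; rewrite tunitrE /tmkr tmkZl -tmkZr /GRing.scale /= mulr1.
Qed.
Lemma hrunVK : cancel hrunV_fun hrun_fun.
Proof.
by move=> x; rewrite /hrun_fun /hrunV_fun tunitrE scale1r -lactM arr_mulV lact1.
Qed.
Lemma hrunVP h x : hrunV_fun (hact X h x) = hact (htens X hunit) h (hrunV_fun x).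
Proof. by apply: (can_inj hrunK); rewrite hrunP !hrunVK. Qed.
Definition hrunV : hhom X (htens X hunit) := HHom hrunV_linear hrunVP.
End Unitors.

Section Braiding.
Variables X Y : hmod.

Definition hbrd_fun (v : htens X Y) : htens Y X :=
  act2 Y X (tflip (Rmat Q)) (tflip v).
Lemma hbrd_linear : linear hbrd_fun.
Proof. by move=> a u v; rewrite /hbrd_fun linearP lactDr lactZr. Qed.
Lemma hbrdP h v : hbrd_fun (hact (htens X Y) h v) = hact (htens Y X) h (hbrd_fun v).
Proof.
rewrite /hbrd_fun !hact_htens lact_tens_flip -!lactM -tflipM.
rewrite -[D h in RHS]tflipK Rmat_cocomm -tflipM.
by rewrite -[in RHS]mulrA RmatV_mul mulr1.
Qed.
Definition hbrd : hhom (htens X Y) (htens Y X) := HHom hbrd_linear hbrdP.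

Definition hbrdV_fun (v : htens Y X) : htens X Y :=
  act2 X Y (RmatV Q) (tflip v).
Lemma hbrdV_linear : linear hbrdV_fun.
Proof. by move=> a u v; rewrite /hbrdV_fun linearP lactDr lactZr. Qed.
Lemma hbrdK : cancel hbrd_fun hbrdV_fun.
Proof.
move=> v; rewrite /hbrd_fun /hbrdV_fun lact_tens_flip !tflipK -lactM.
by rewrite RmatV_mul lact1.
Qed.
Lemma hbrdVK : cancel hbrdV_fun hbrd_fun.
Proof.
move=> v; rewrite /hbrd_fun /hbrdV_fun lact_tens_flip tflipK -lactM -tflipM.
by rewrite Rmat_mulV /tflip -tmk1 (tliftE (tflip_bilin _ _)) lact1.
Qed.
Lemma hbrdVP h v :
  hbrdV_fun (hact (htens Y X) h v) = hact (htens X Y) h (hbrdV_fun v).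
Proof. by apply: (can_inj hbrdK); rewrite hbrdP !hbrdVK. Qed.
Definition hbrdV : hhom (htens Y X) (htens X Y) := HHom hbrdV_linear hbrdVP.
End Braiding.
End HModules.
Arguments hasc_fun {k H} Q {X Y Z}.
Arguments hascV_fun {k H} Q {X Y Z}.
Arguments hbrd_fun {k H} Q {X Y}.
Arguments hbrdV_fun {k H} Q {X Y}.

Section HModulesBraided.
Variables (k : fieldType) (H : algType k) (Q : quasitriangular H).

Let D := Delta Q.
Local Notation "X ** Y" := (htens Q X Y) (at level 40, left associativity).

Section Permutations.
Variables X Y Z : hmod H.

Lemma act3_132 t v :
  tmap idfun (@tflip k Y Z) (act3 X Y Z t v) =
  act3 X Z Y (perm132 t) (tmap idfun (@tflip k Y Z) v).
Proof.
apply: (lact_tens_map (p := idfun) (q := @tflip k H H)) => // b y.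
exact: lact_tens_flip.
Qed.

Lemma act3_231 t v :
  tassoc (tflip (act3 X Y Z t v)) = act3 Y Z X (perm231 t) (tassoc (tflip v)).
Proof. by rewrite lact_tens_flip lact_tens_assoc. Qed.

Lemma act3_312 t v :
  tflip (tassocV (act3 X Y Z t v)) = act3 Z X Y (perm312 t) (tflip (tassocV v)).
Proof. by rewrite lact_tens_assocV lact_tens_flip. Qed.

Lemma act3_213 t v :
  tassoc (tmap (@tflip k X Y) idfun (tassocV (act3 X Y Z t v))) =
  act3 Y X Z (perm213 t) (tassoc (tmap (@tflip k X Y) idfun (tassocV v))).
Proof.
rewrite lact_tens_assocV -lact_tens_assoc; congr tassoc.
apply: (lact_tens_map (p := @tflip k H H) (q := idfun)) => // b y.
exact: lact_tens_flip.
Qed.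
End Permutations.

Lemma tassoc_coh (A B C E : lmodType k) (v : tens (tens (tens A B) C) E) :
  tmap idfun (@tassoc k B C E) (tassoc (tmap (@tassoc k A B C) idfun v)) =
  tassoc (tassoc v).
Proof.
have := tens_ext (f := tmap idfun (@tassoc k B C E) \o @tassoc k A (tens B C) E
    \o tmap (@tassoc k A B C) idfun)
  (g := @tassoc k A B (tens C E) \o @tassoc k (tens A B) C E) _ v.
apply=> u z.
have := tens_ext3l (f := tmap idfun (@tassoc k B C E) \o @tassoc k A (tens B C) E
    \o tmap (@tassoc k A B C) idfun \o tmkr z)
  (g := @tassoc k A B (tens C E) \o @tassoc k (tens A B) C E \o tmkr z) _ u.
apply=> a b c /=.
by rewrite /tmkr tmapE /= !tassocE tmapE /= tassocE.
Qed.

Lemma tmap_tassocM :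
  {morph tmap (idfun : {linear H -> H}) (@tassoc k H H H) : s t / s * t}.
Proof.
move=> s t.
have h := lact_tens_map (rho := lact_reg H) (rho' := lact_reg H)
  (sig := lact_reg (tens (tens H H) H)) (sig' := lact_reg (tens H (tens H H)))
  (f := idfun) (g := @tassoc k H H H) (p := idfun) (q := @tassoc k H H H).
by apply h => //; apply: tassocM.
Qed.

Lemma perm132M : {morph @perm132 k H : s t / s * t}.
Proof.
move=> s t; apply: (lact_tens_map (rho := lact_reg H) (rho' := lact_reg H)
  (sig := lact_reg _) (sig' := lact_reg _) (p := idfun) (q := @tflip k H H)) => //.
exact: tflipM.
Qed.

Lemma perm213M : {morph @perm213 k H : s t / s * t}.
Proof.
move=> s t.
have h := lact_tens_map (rho := lact_reg (tens H H)) (rho' := lact_reg (tens H H))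
  (sig := lact_reg H) (sig' := lact_reg H)
  (f := @tflip k H H) (g := idfun) (p := @tflip k H H) (q := idfun).
have {}h : {morph tmap (@tflip k H H) (idfun : {linear H -> H}) : s t / s * t}.
  by move=> s' t'; apply h => // a x; apply: tflipM.
rewrite /perm213 -tassocM; congr tassoc; rewrite -h; congr tmap.
exact: tassocVM.
Qed.

Lemma perm231M : {morph @perm231 k H : s t / s * t}.
Proof. by move=> s t; rewrite /perm231 -tassocM; congr tassoc; apply: tflipM. Qed.

Lemma perm312M : {morph @perm312 k H : s t / s * t}.
Proof. by move=> s t; rewrite /perm312 -tflipM; congr tflip; apply: tassocVM. Qed.

Lemma perm231_312 : cancel (@perm312 k H) (@perm231 k H).
Proof. by move=> t; rewrite /perm231 /perm312 tflipK tassocVK. Qed.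

Lemma perm312_231 : cancel (@perm231 k H) (@perm312 k H).
Proof. by move=> t; rewrite /perm231 /perm312 tassocK tflipK. Qed.

Lemma htmor1 (X Y : hmod H) : htmor Q (hid X) (hid Y) = hid (X ** Y).
Proof.
apply: hhom_ext => v; have := tens_ext (f := tmap idfun idfun) (g := idfun) _ v.
by apply=> x y /=; rewrite tmapE.
Qed.

Lemma htmor_comp (X X' X'' Y Y' Y'' : hmod H) (f' : hhom X' X'')
    (f : hhom X X') (g' : hhom Y' Y'') (g : hhom Y Y') :
  htmor Q (hcomp f' f) (hcomp g' g) = hcomp (htmor Q f' g') (htmor Q f g).
Proof.
apply: hhom_ext => v; rewrite /= /htmor_fun.
elim/tens_indW: v => [|x y v ih]; first by rewrite !linear0.
rewrite linearD [in RHS]linearD [in RHS]linearD /= ih; congr (_ + _).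
by rewrite !tmapE.
Qed.

Lemma hasc_nat (X X' Y Y' Z Z' : hmod H)
    (f : hhom X X') (g : hhom Y Y') (h : hhom Z Z') :
  hcomp (hasc Q X' Y' Z') (htmor Q (htmor Q f g) h) =
  hcomp (htmor Q f (htmor Q g h)) (hasc Q X Y Z).
Proof.
apply: hhom_ext => v; rewrite /= /htmor_fun /hasc_fun.
have -> : tassoc (tmap (htmor Q f g) h v) = tmap f (htmor Q g h) (tassoc v).
  have := tens_ext3l (f := tassoc (W := Z') \o tmap (htmor Q f g) h)
                     (g := tmap f (htmor Q g h) \o tassoc (W := Z)) _ v.
  by apply=> x y z /=; rewrite !(tmapE, tassocE) /= /htmor_fun !tmapE tassocE.
symmetry; etransitivity.
  exact: (lact_tens_map (g := htmor Q g h) (p := idfun) (q := idfun)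
    (rho' := hact X') (sig' := act2 Y' Z') (hfunP f) (act2_map g h)).
congr (lact_fun _ _ _).
have := tens_ext (f := tmap idfun idfun) (g := idfun) _ (Phi Q).
by apply=> a b /=; rewrite tmapE.
Qed.

Lemma hasc_ascV (X Y Z : hmod H) : hcomp (hasc Q X Y Z) (hascV Q X Y Z) = hid _.
Proof.
apply: hhom_ext => v; rewrite /= /hasc_fun /hascV_fun tassocVK -lactM.
by rewrite Phi_mulV lact1.
Qed.

Lemma hascV_asc (X Y Z : hmod H) : hcomp (hascV Q X Y Z) (hasc Q X Y Z) = hid _.
Proof.
apply: hhom_ext => v; rewrite /= /hasc_fun /hascV_fun -lactM.
by rewrite PhiV_mul lact1 tassocK.
Qed.

Lemma hlun_nat (X X' : hmod H) (f : hhom X X') :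
  hcomp (hlun Q X') (htmor Q (hid (hunit Q)) f) = hcomp f (hlun Q X).
Proof.
apply: hhom_ext => v; rewrite /= /htmor_fun /hlun_fun hfunP; congr (lact_fun _ _ _).
have := tens_ext (f := tunitl (V := X') \o tmap (hid (hunit Q)) f)
  (g := f \o tunitl (V := X)) _ v.
by apply=> a x /=; rewrite tmapE !tunitlE linearZ.
Qed.

Lemma hrun_nat (X X' : hmod H) (f : hhom X X') :
  hcomp (hrun Q X') (htmor Q f (hid (hunit Q))) = hcomp f (hrun Q X).
Proof.
apply: hhom_ext => v; rewrite /= /htmor_fun /hrun_fun hfunP; congr (lact_fun _ _ _).
have := tens_ext (f := tunitr (V := X') \o tmap f (hid (hunit Q)))
  (g := f \o tunitr (V := X)) _ v.
by apply=> x a /=; rewrite tmapE !tunitrE linearZ.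
Qed.

Lemma hlun_lunV (X : hmod H) : hcomp (hlun Q X) (hlunV Q X) = hid _.
Proof. exact/hhom_ext/hlunVK. Qed.
Lemma hlunV_lun (X : hmod H) : hcomp (hlunV Q X) (hlun Q X) = hid _.
Proof. exact/hhom_ext/hlunK. Qed.
Lemma hrun_runV (X : hmod H) : hcomp (hrun Q X) (hrunV Q X) = hid _.
Proof. exact/hhom_ext/hrunVK. Qed.
Lemma hrunV_run (X : hmod H) : hcomp (hrunV Q X) (hrun Q X) = hid _.
Proof. exact/hhom_ext/hrunK. Qed.

Lemma tmapl_act (X Y : hmod H) (V W : lmodType k) (B : algType k)
    (nu : lact B W) (f f' : {linear V -> X}) b v : 
  (forall y, f' y = hact X b (f y)) ->
  tmap f' (idfun : W -> W) v =
  lact_tens (hact X) nu (b \ox 1) (tmap f (idfun : W -> W) v).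
Proof.
by move=> h; apply: tmap_act => // y /=; rewrite lact1.
Qed.

Lemma hasc_pentagon (W X Y Z : hmod H) :
  hcomp (hcomp (htmor Q (hid W) (hasc Q X Y Z)) (hasc Q W (X ** Y) Z))
    (htmor Q (hasc Q W X Y) (hid Z))
  = hcomp (hasc Q W X (Y ** Z)) (hasc Q (W ** X) Y Z).
Proof.
apply: hhom_ext => v; rewrite /= /htmor_fun.
pose a4 := lact_tens (hact W) (act3 X Y Z).
have -> : tmap (hasc Q W X Y) (hid Z) v = lact_tens (act3 W X Y) (hact Z)
    (Phi Q \ox 1) (tmap (@tassoc k W X Y) idfun v).
  by apply: tmap_act => // z /=; rewrite lact1.
set v1 := tmap _ _ v.
have -> : @hasc_fun k H Q W (X ** Y) Z (lact_tens (act3 W X Y) (hact Z) (Phi Q \ox 1) v1) =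
    lact_tens (hact W) (lact_tens (act2 X Y) (hact Z))
     (tmap idfun (tmap D idfun) (Phi Q) * tassoc (Phi Q \ox 1)) (tassoc v1).
  rewrite lactM /hasc_fun lact_tens_assoc.
  apply: (lact_tens_pull (p := idfun) (q := tmap D idfun)) => // b y.
  exact: (lact_tens_pull (rho' := act2 X Y) (sig' := hact Z) (p := D) (q := idfun)).
have -> u : tmap (hid W) (hasc Q X Y Z) u =
    a4 (1 \ox Phi Q) (tmap idfun (@tassoc k X Y Z) u).
  by apply: tmap_act => // w /=; rewrite lact1.
have -> t u : tmap idfun (@tassoc k X Y Z)
     (lact_tens (hact W) (lact_tens (act2 X Y) (hact Z)) t u) =
    a4 (tmap idfun (@tassoc k H H H) t) (tmap idfun (@tassoc k X Y Z) u).
  have h := lact_tens_map (rho := hact W) (rho' := hact W)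
    (sig := lact_tens (act2 X Y) (hact Z)) (sig' := act3 X Y Z)
    (f := idfun) (g := @tassoc k X Y Z) (p := idfun) (q := @tassoc k H H H).
  by apply h => // b y; apply: lact_tens_assoc.
rewrite -lactM tmap_tassocM mulrA -Phi_pentagon lactM.
have -> u : @hasc_fun k H Q W X (Y ** Z) u =
    a4 (tmap idfun (tmap idfun D) (Phi Q)) (tassoc u).
  rewrite /hasc_fun.
  apply: (lact_tens_pull (p := idfun) (q := tmap idfun D)) => // b y.
  exact: (lact_tens_pull (rho' := hact X) (sig' := act2 Y Z) (p := idfun) (q := D)).
congr (lact_fun _ _ _); rewrite /hasc_fun.
have -> : act3 (W ** X) Y Z (Phi Q) (tassoc v) =
    lact_tens (act2 W X) (act2 Y Z) (tmap D idfun (Phi Q)) (tassoc v).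
  exact: (lact_tens_pull (rho' := act2 W X) (sig' := act2 Y Z) (p := D) (q := idfun)).
rewrite lact_tens_assoc; congr (lact_fun _ _ _); rewrite {}/v1.
exact: tassoc_coh.
Qed.

Lemma hasc_triangle (X Y : hmod H) :
  hcomp (htmor Q (hid X) (hlun Q Y)) (hasc Q X (hunit Q) Y) =
  htmor Q (hrun Q X) (hid Y).
Proof.
apply: hhom_ext => v; rewrite /= /htmor_fun /hasc_fun.
have -> u : tmap (hid X) (hlun Q Y) u =
    act2 X Y (1 \ox ell Q) (tmap idfun (@tunitl k Y) u).
  by apply: tmap_act => // x /=; rewrite lact1.
have -> t u : tmap idfun (@tunitl k Y) (act3 X (hunit Q) Y t u) =
    act2 X Y (tmap idfun (@tunitl k H \o tmap (eps Q) idfun) t)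
      (tmap idfun (@tunitl k Y) u).
  apply: (lact_tens_map (rho := hact X) (rho' := hact X) (sig := act2 (hunit Q) Y)
    (sig' := hact Y) (f := idfun) (g := @tunitl k Y) (p := idfun)
    (q := @tunitl k H \o tmap (eps Q) idfun)) => // b y.
  exact: tunitl_eps.
have -> : tmap idfun (@tunitl k H \o tmap (eps Q) idfun) (Phi Q) = arr Q \ox ellV Q.
  rewrite -Phi_triangle.
  have := tens_ext (f := tmap idfun (@tunitl k H \o tmap (eps Q) idfun))
    (g := tmap idfun (@tunitl k H) \o tmap idfun (tmap (eps Q) idfun)) _ (Phi Q).
  by apply=> a b /=; rewrite !tmapE.
rewrite -lactM tmkM mul1r ell_mulV.
have -> : tmap (hrun Q X) (hid Y) v =
    act2 X Y (arr Q \ox 1) (tmap (@tunitr k X) idfun v).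
  by apply: tmap_act => // y /=; rewrite lact1.
congr (lact_fun _ _ _).
have := tens_ext3l (f := tmap idfun (@tunitl k Y) \o @tassoc k X k^o Y)
  (g := tmap (@tunitr k X) idfun) _ v.
by apply=> x a y /=; rewrite tassocE !tmapE /= tunitlE tunitrE tmkZl tmkZr.
Qed.

Definition hmod_monoidal : monoidal :=
  @Monoidal (hmod_preadditive H) (htens Q) (@htmor _ _ Q) (hunit Q)
    (hasc Q) (hascV Q) (hlun Q) (hlunV Q) (hrun Q) (hrunV Q)
    htmor1 htmor_comp hasc_nat hasc_ascV hascV_asc hlun_nat hlun_lunV hlunV_lun
    hrun_nat hrun_runV hrunV_run hasc_pentagon hasc_triangle.

Lemma hbrd_nat (X X' Y Y' : hmod H) (f : hhom X X') (g : hhom Y Y') :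
  hcomp (hbrd Q X' Y') (htmor Q f g) = hcomp (htmor Q g f) (hbrd Q X Y).
Proof.
apply: hhom_ext => v; rewrite /= /htmor_fun /hbrd_fun act2_map.
congr (lact_fun _ _ _).
have := tens_ext (f := @tflip k X' Y' \o tmap f g)
  (g := tmap g f \o @tflip k X Y) _ v.
by apply=> x y /=; rewrite !(tflipE, tmapE).
Qed.

Lemma hbrd_brdV (X Y : hmod H) : hcomp (hbrd Q X Y) (hbrdV Q X Y) = hid _.
Proof. exact/hhom_ext/hbrdVK. Qed.
Lemma hbrdV_brd (X Y : hmod H) : hcomp (hbrdV Q X Y) (hbrd Q X Y) = hid _.
Proof. exact/hhom_ext/hbrdK. Qed.

Lemma tflip_1 (A B : algType k) : tflip (1 : tens A B) = 1.
Proof. exact: tflipE. Qed.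

Lemma perm231_1 : perm231 (1 : tens H (tens H H)) = 1.
Proof. exact: perm231E. Qed.

Lemma perm312_1 : perm312 (1 : tens H (tens H H)) = 1.
Proof. exact: perm312E. Qed.

Lemma tflip_map (V V' W W' : lmodType k) (f : {linear V -> V'})
  (g : {linear W -> W'}) v : tflip (tmap f g v) = tmap g f (tflip v).
Proof.
have := tens_ext (f := @tflip k V' W' \o tmap f g)
  (g := tmap g f \o @tflip k V W) _ v.
by apply=> x y /=; rewrite !(tflipE, tmapE).
Qed.

Lemma R_hexagon1 :
  Phi Q * tassoc (tmap D idfun (tflip (Rmat Q))) * perm231 (Phi Q) =
  (1 \ox tflip (Rmat Q)) * perm132 (Phi Q)
    * perm132 (tassoc (tflip (Rmat Q) \ox 1)).
Proof.
have -> : tassoc (tmap D idfun (tflip (Rmat Q))) =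
    perm231 (tmap idfun D (Rmat Q)) by rewrite /perm231 tflip_map.
rewrite Rmat_idDelta !perm231M perm231_312 !mulrA Phi_mulV mul1r.
rewrite -!mulrA -perm231M PhiV_mul perm231_1 mulr1.
congr (_ * (_ * _)).
- have := tens_ext (f := @tassoc k H H H \o (@tflip k _ _) \o tmap idfun (tmkl 1))
    (g := tmkl 1 \o @tflip k H H) _ (Rmat Q).
  by apply=> a b /=; rewrite tmapE !tflipE /tmkl tassocE.
- have := tens_ext3 (f := @tassoc k H H H \o @tflip k _ _ \o
      (@tassoc k H H H \o tmap (@tflip k H H) idfun \o @tassocV k H H H))
    (g := tmap idfun (@tflip k H H)) _ (Phi Q).
  apply=> a b c.
  change (perm231 (perm213 (a \ox (b \ox c))) = perm132 (a \ox (b \ox c))).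
  by rewrite perm213E perm231E perm132E.
- have := tens_ext (f := @tassoc k H H H \o (@tflip k _ _) \o
      (@tassoc k H H H \o tmkr 1))
    (g := tmap idfun (@tflip k H H) \o @tassoc k H H H \o tmkr 1 \o
      @tflip k H H) _ (Rmat Q).
  by apply=> a b /=; rewrite !tflipE /tmkr !tassocE tflipE tmapE tassocE /= tflipE.
Qed.

Lemma R_hexagon2 :
  PhiV Q * tmap idfun D (tflip (Rmat Q)) * perm312 (PhiV Q) =
  tassoc (tflip (Rmat Q) \ox 1) * perm213 (PhiV Q)
    * perm213 (1 \ox tflip (Rmat Q)).
Proof.
have -> : tmap idfun D (tflip (Rmat Q)) =
    perm312 (tassoc (tmap D idfun (Rmat Q))).
  by rewrite /perm312 tassocK tflip_map.
rewrite Rmat_Deltaid !perm312M perm312_231 !mulrA PhiV_mul mul1r.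
rewrite -!mulrA -perm312M Phi_mulV perm312_1 mulr1.
congr (_ * (_ * _)).
- have := tens_ext (f := @tflip k _ _ \o @tassocV k H H H \o tmap idfun (tmkl 1))
    (g := @tassoc k H H H \o tmkr 1 \o @tflip k H H) _ (Rmat Q).
  by apply=> a b /=; rewrite tmapE /tmkl tassocVE !tflipE /tmkr tassocE.
- have := tens_ext3 (f := @tflip k _ _ \o @tassocV k H H H \o
      tmap idfun (@tflip k H H))
    (g := @tassoc k H H H \o tmap (@tflip k H H) idfun \o @tassocV k H H H)
    _ (PhiV Q).
  apply=> a b c.
  change (perm312 (perm132 (a \ox (b \ox c))) = perm213 (a \ox (b \ox c))).
  by rewrite perm213E perm132E perm312E.
- have := tens_ext (f := @tflip k _ _ \o @tassocV k H H H \o tmkl 1)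
    (g := @tassoc k H H H \o tmap (@tflip k H H) idfun \o @tassocV k H H H \o
      tmkl 1 \o @tflip k H H) _ (Rmat Q).
  apply=> a b.
  change (perm312 (1 \ox (a \ox b)) = perm213 (1 \ox tflip (a \ox b))).
  by rewrite tflipE perm312E perm213E.
Qed.

Lemma hbrd_hexagon1 (X Y Z : hmod H) :
  hcomp (hcomp (hasc Q Y Z X) (hbrd Q X (Y ** Z))) (hasc Q X Y Z) =
  hcomp (hcomp (htmor Q (hid Y) (hbrd Q X Z)) (hasc Q Y X Z))
    (htmor Q (hbrd Q X Y) (hid Z)).
Proof.
apply: hhom_ext => v; rewrite /= /htmor_fun.
rewrite {1 2}/hasc_fun {1}/hbrd_fun act2_htensl act3_231 -!lactM R_hexagon1.
have -> : tmap (hbrd Q X Y) (hid Z) v =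
    lact_tens (act2 Y X) (hact Z) (tflip (Rmat Q) \ox 1)
      (tmap (@tflip k X Y) idfun v).
  by apply: tmap_act => // z /=; rewrite lact1.
have -> u : tmap (hid Y) (hbrd Q X Z) u =
    act3 Y Z X (1 \ox tflip (Rmat Q)) (tmap idfun (@tflip k X Z) u).
  by apply: tmap_act => // y /=; rewrite lact1.
rewrite /hasc_fun lact_tens_assoc -lactM act3_132 perm132M -!lactM !mulrA.
congr (lact_fun _ _ _).
have := tens_ext3l (f := @tassoc k Y Z X \o @tflip k _ _ \o @tassoc k X Y Z)
  (g := tmap idfun (@tflip k X Z) \o @tassoc k Y X Z \o
     tmap (@tflip k X Y) idfun) _ v.
apply=> x y z /=; rewrite !(tassocE, tflipE, tmapE) /=. 
by rewrite tflipE tassocE tmapE /= tflipE.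
Qed.

Lemma hbrd_hexagon2 (X Y Z : hmod H) :
  hcomp (hcomp (hascV Q Z X Y) (hbrd Q (X ** Y) Z)) (hascV Q X Y Z) =
  hcomp (hcomp (htmor Q (hbrd Q X Z) (hid Y)) (hascV Q X Z Y))
    (htmor Q (hid X) (hbrd Q Y Z)).
Proof.
apply: hhom_ext => v; rewrite /= /htmor_fun.
apply: (can_inj (@tassocK _ _ _ _)).
rewrite {1}/hascV_fun tassocVK {1}/hbrd_fun act2_htensr.
rewrite {1}/hascV_fun act3_312 -!lactM R_hexagon2.
have -> u : tmap (hbrd Q X Z) (hid Y) u =
    lact_tens (act2 Z X) (hact Y) (tflip (Rmat Q) \ox 1)
      (tmap (@tflip k X Z) idfun u).
  by apply: tmap_act => // z /=; rewrite lact1.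
have -> : tmap (hid X) (hbrd Q Y Z) v =
    act3 X Z Y (1 \ox tflip (Rmat Q)) (tmap idfun (@tflip k Y Z) v).
  by apply: tmap_act => // y /=; rewrite lact1.
rewrite /hascV_fun -lactM lact_tens_assoc act3_213 perm213M -!lactM !mulrA.
congr (lact_fun _ _ _).
have := tens_ext3 (f := @tflip k _ _ \o @tassocV k X Y Z)
  (g := @tassoc k Z X Y \o tmap (@tflip k X Z) idfun \o @tassocV k X Z Y \o
    tmap idfun (@tflip k Y Z)) _ v.
apply=> x y z /=.
by rewrite tassocVE tflipE tmapE /= tflipE tassocVE tmapE /= tflipE tassocE.
Qed.

Definition hmod_braided : braided :=
  @Braided hmod_monoidal (hbrd Q) (hbrdV Q) hbrd_nat hbrd_brdV hbrdV_brd
    hbrd_hexagon1 hbrd_hexagon2.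
End HModulesBraided.

(* Main.v *)
Require Import Defs.
From HB Require Import structures.
From mathcomp Require Import all_boot all_order all_algebra.
From mathcomp Require Import boolp.

Set Implicit Arguments.
Unset Strict Implicit.
Unset Printing Implicit Defensive.

Import GRing.Theory.
Local Open Scope ring_scope.

(** A natural endomorphism [t] of the tensor product of H-modules is determined
    by its value [chi] at [1 \ox 1] in the tensor square of the regular module:
    an element [x] of [X] is the image of [1] under the H-linear map
    [h |-> h x], so naturality along two such maps forces
    [t (x \ox y) = chi . (x \ox y)] ([ibr_act]).

    It remains to compare axioms. The action of [chi] is natural in H-linear
    maps for free, and it is itself H-linear when [chi] commutes with the
    coproduct. When [t] is the action of [chi], both sides of each
    infinitesimal hexagon are actions of an element of the triple tensor power
    of [H]: the left side because [H] acts on [Y \ox Z] through the coproduct,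
    the right side because each associator, braiding and copy of [t] in the
    composite acts by an element up to a permutation of the factors, and these
    permutations can be pushed to the right until they cancel, permuting the
    legs of the elements that they cross ([ib_tensr_act], [ib_tensl_act]). The
    elements obtained are the two sides of the corresponding axiom of an
    infinitesimal R-matrix, so that axiom implies the hexagon. Conversely,
    elements acting in the same way on the triple tensor power of the regular
    module are equal ([act3_reg_inj]), so the hexagon implies the axiom. *)

Section InfinitesimalBraidings.
Variables (k : fieldType) (H : algType k) (Q : quasitriangular H).

Local Notation D := (Delta Q).
Local Notation C := (hmod_braided Q).
Local Notation "X ** Y" := (htens Q X Y) (at level 40, left associativity).
Local Notation HH := (hmod_reg H).

(** * Permuting legs and factors *)

Lemma perm213_leg12_flip (t : tens H H) : perm213 (leg12 (tflip t)) = leg12 t.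
Proof.
have := tens_ext (f := @tassoc k H H H \o tmap (@tflip k H H) idfun \o
    @tassocV k H H H \o @tassoc k H H H \o tmkr 1 \o @tflip k H H)
  (g := @tassoc k H H H \o tmkr 1) _ t.
apply=> a b; change (perm213 (leg12 (tflip (a \ox b))) = leg12 (a \ox b)).
by rewrite tflipE !leg12E perm213E.
Qed.

Lemma perm213_leg23 (t : tens H H) : perm213 (leg23 t) = leg13 t.
Proof.
have := tens_ext (f := @tassoc k H H H \o tmap (@tflip k H H) idfun \o
    @tassocV k H H H \o tmkl 1) (g := tmap idfun (tmkl 1)) _ t.
apply=> a b; change (perm213 (leg23 (a \ox b)) = leg13 (a \ox b)).
by rewrite perm213E leg13E.
Qed.

Lemma perm132_leg23_flip (t : tens H H) : perm132 (leg23 (tflip t)) = leg23 t.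
Proof. by rewrite /perm132 /leg23 tmapE /= tflipK. Qed.

Lemma perm132_leg12 (t : tens H H) : perm132 (leg12 t) = leg13 t.
Proof.
have := tens_ext (f := tmap idfun (@tflip k H H) \o @tassoc k H H H \o tmkr 1)
  (g := tmap idfun (tmkl 1)) _ t.
apply=> a b; change (perm132 (leg12 (a \ox b)) = leg13 (a \ox b)).
by rewrite leg12E perm132E leg13E.
Qed.

Section Swaps.
Variables U V W : lmodType k.

Definition swap12 (v : tens U (tens V W)) : tens V (tens U W) :=
  tassoc (tmap (@tflip k U V) idfun (tassocV v)).

Definition swap23 (v : tens U (tens V W)) : tens U (tens W V) :=
  tmap idfun (@tflip k V W) v.
End Swaps.

Lemma swap12K (U V W : lmodType k) : cancel (@swap12 U V W) (@swap12 V U W).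
Proof.
move=> v; have := tens_ext3 (f := @tassoc k U V W \o tmap (@tflip k V U) idfun \o
    @tassocV k V U W \o @tassoc k V U W \o tmap (@tflip k U V) idfun \o
    @tassocV k U V W) (g := idfun) _ v.
apply=> x y z /=; by rewrite tassocVE tmapE /= tflipE tassocK tmapE /= tflipE tassocE.
Qed.

Lemma swap23K (U V W : lmodType k) : cancel (@swap23 U V W) (@swap23 U W V).
Proof.
move=> v; have := tens_ext3 (f := tmap idfun (@tflip k W V) \o
    tmap idfun (@tflip k V W)) (g := idfun) _ v.
by apply=> x y z /=; rewrite !tmapE /= tflipK.
Qed.

(** * Hexagon sides as actions *)

Section Whiskering.
Variables X Y Z : hmod H.

Lemma swap12_act3 t v :
  swap12 (act3 X Y Z t v) = act3 Y X Z (perm213 t) (swap12 v).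
Proof. exact: act3_213. Qed.

Lemma swap23_act3 t v :
  swap23 (act3 X Y Z t v) = act3 X Z Y (perm132 t) (swap23 v).
Proof. exact: act3_132. Qed.

(** The braiding and its inverse are actions composed with a flip, so
    whiskering them gives a leg embedding composed with a swap. Right
    whiskerings live on the left-bracketed product, whence the associators. *)
Lemma tmap_brdl v : tassoc (tmap (hbrd Q X Y) (hid Z) v) =
  act3 Y X Z (leg12 (tflip (Rmat Q))) (swap12 (tassoc v)).
Proof.
rewrite /swap12 tassocK -[RHS]lact_tens_assoc; congr tassoc.
by apply: tmap_act => // z /=; rewrite lact1.
Qed.

Lemma tmap_brdVl v : tassoc (tmap (hbrdV Q X Y) (hid Z) v) =
  act3 X Y Z (leg12 (RmatV Q)) (swap12 (tassoc v)).
Proof.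
rewrite /swap12 tassocK -[RHS]lact_tens_assoc; congr tassoc.
by apply: tmap_act => // z /=; rewrite lact1.
Qed.

Lemma tmap_brdr v : tmap (hid X) (hbrd Q Y Z) v =
  act3 X Z Y (leg23 (tflip (Rmat Q))) (swap23 v).
Proof. by apply: tmap_act => // x /=; rewrite lact1. Qed.

Lemma tmap_brdVr v : tmap (hid X) (hbrdV Q Y Z) v =
  act3 X Y Z (leg23 (RmatV Q)) (swap23 v).
Proof. by apply: tmap_act => // x /=; rewrite lact1. Qed.

Lemma tmap_id (U V : lmodType k) (v : tens U V) : tmap idfun idfun v = v.
Proof.
have := tens_ext (f := tmap idfun idfun) (g := idfun) _ v.
by apply=> x y /=; rewrite tmapE.
Qed.

Lemma tmap_actl (f : hhom (X ** Y) (X ** Y)) chi v :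
  (forall u, f u = act2 X Y chi u) ->
  tassoc (tmap f (hid Z) v) = act3 X Y Z (leg12 chi) (tassoc v).
Proof.
move=> fE; rewrite -[RHS]lact_tens_assoc; congr tassoc.
rewrite -[in RHS](tmap_id v).
by apply: tmap_act => // z /=; rewrite lact1.
Qed.

Lemma tmap_actr (f : hhom (Y ** Z) (Y ** Z)) chi v :
  (forall u, f u = act2 Y Z chi u) ->
  tmap (hid X) f v = act3 X Y Z (leg23 chi) v.
Proof.
move=> fE; rewrite -[in RHS](tmap_id v).
by apply: tmap_act => // x /=; rewrite lact1.
Qed.
End Whiskering.

Section FamilyOfActions.
Variables (t : forall X Y : hmod H, hhom (X ** Y) (X ** Y)) (chi : tens H H).
Hypothesis t_act : forall X Y v, t X Y v = act2 X Y chi v.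

(** Outermost to innermost, the long composite acts by the successive factors
    of the first product. The braiding and its inverse each bring a swap of the
    first two factors of the module; the two swaps cancel, and the factors
    between them change from actions on [Y (X Z)] to actions on [X (Y Z)], which
    is where the 213 legs come from. *)
Lemma ib_tensr_act (X Y Z : hmod H) v :
  (hcomp (hcomp (hasc Q X Y Z) (htmor Q (t X Y) (hid Z))) (hascV Q X Y Z)
   + hcomp (hcomp (hcomp (hcomp (hcomp (hcomp
       (hasc Q X Y Z) (htmor Q (hbrdV Q X Y) (hid Z))) (hascV Q Y X Z))
       (htmor Q (hid Y) (t X Z))) (hasc Q Y X Z))
       (htmor Q (hbrd Q X Y) (hid Z))) (hascV Q X Y Z)) v =
  act3 X Y Z
    (Phi Q * leg12 (RmatV Q) * perm213 (PhiV Q) * leg13 chi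
       * perm213 (Phi Q) * leg12 (Rmat Q) * PhiV Q
     + Phi Q * leg12 chi * PhiV Q) v.
Proof.
(* The R-matrix axiom lists its two summands in the opposite order. *)
rewrite lactDl addrC /= /htmor_fun /hasc_fun /hascV_fun; congr (_ + _).
  rewrite tmap_brdVl tmap_brdl !tassocVK (tmap_actr _ (@t_act X Z)).
  rewrite -!lactM swap12_act3 swap12K -!lactM.
  by rewrite !perm213M perm213_leg12_flip perm213_leg23 !mulrA.
by rewrite (tmap_actl _ (@t_act X Y)) tassocVK -!lactM.
Qed.

(** The mirror image of [ib_tensr_act]; both sides are transported along
    [tassoc] because triple actions are defined on right-bracketed products. *)
Lemma ib_tensl_act (X Y Z : hmod H) v :
  tassoc
  ((hcomp (hcomp (hascV Q X Y Z) (htmor Q (hid X) (t Y Z))) (hasc Q X Y Z)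
   + hcomp (hcomp (hcomp (hcomp (hcomp (hcomp
       (hascV Q X Y Z) (htmor Q (hid X) (hbrdV Q Y Z))) (hasc Q X Z Y))
       (htmor Q (t X Z) (hid Y))) (hascV Q X Z Y))
       (htmor Q (hid X) (hbrd Q Y Z))) (hasc Q X Y Z)) v) =
  act3 X Y Z
    (PhiV Q * leg23 (RmatV Q) * perm132 (Phi Q) * leg13 chi
       * perm132 (PhiV Q) * leg23 (Rmat Q) * Phi Q
     + PhiV Q * leg23 chi * Phi Q) (tassoc v).
Proof.
rewrite lactDl addrC /= /htmor_fun /hasc_fun /hascV_fun linearD /=.
rewrite !tassocVK; congr (_ + _).
  rewrite tmap_brdVr tmap_brdr (tmap_actl _ (@t_act X Z)) tassocVK.
  rewrite -!lactM swap23_act3 swap23K -!lactM.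
  by rewrite !perm132M perm132_leg23_flip perm132_leg12 !mulrA.
by rewrite (tmap_actr _ (@t_act Y Z)) -!lactM.
Qed.
End FamilyOfActions.

(** * From infinitesimal R-matrices to infinitesimal braidings *)

Section ActionBraiding.
Variable chi : inf_Rmatrix Q.

Section Component.
Variables X Y : hmod H.

Definition chi_fun (v : X ** Y) : X ** Y := act2 X Y (sval chi) v.

Lemma chi_linear : linear chi_fun.
Proof. by move=> a u v; rewrite /chi_fun lactDr lactZr. Qed.

Lemma chi_hact h v :
  chi_fun (hact (X ** Y) h v) = hact (X ** Y) h (chi_fun v).
Proof. by rewrite /chi_fun !hact_htens -!lactM; case: (svalP chi) => ->. Qed.

Definition chi_hom : hhom (X ** Y) (X ** Y) := HHom chi_linear chi_hact.
End Component.

Lemma chi_hom_nat (X X' Y Y' : hmod H) (f : hhom X X') (g : hhom Y Y') :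
  hcomp (chi_hom X' Y') (htmor Q f g) = hcomp (htmor Q f g) (chi_hom X Y).
Proof. by apply: hhom_ext => v; rewrite /= /htmor_fun /chi_fun act2_map. Qed.

Definition inf_braiding_of : inf_braiding C.
Proof.
apply: (@InfBraiding C chi_hom) => [X X' Y Y' f g|X Y Z|X Y Z].
- exact: chi_hom_nat.
- apply: hhom_ext => v.
  rewrite [RHS](@ib_tensr_act chi_hom (sval chi)) //= /chi_fun act2_htensr.
  by case: (svalP chi) => _ <-.
- apply: hhom_ext => v; apply: (can_inj (@tassocK _ _ _ _)).
  rewrite [RHS](@ib_tensl_act chi_hom (sval chi)) //= /chi_fun act2_htensl.
  by case: (svalP chi) => _ _ <-.
Defined.
End ActionBraiding.

(** * From infinitesimal braidings to infinitesimal R-matrices *)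

Section Orbit.
Variables (X : hmod H) (x : X).

Lemma orbit_linear : linear (fun h : HH => hact X h x).
Proof. by move=> a h h'; rewrite lactDl lactZl. Qed.

Lemma orbit_hact h (h' : HH) : hact X (hact HH h h') x = hact X h (hact X h' x).
Proof. exact: lactM. Qed.

Definition orbit_hom : hhom HH X := HHom orbit_linear orbit_hact.
End Orbit.

Definition ibr_elt (t : inf_braiding C) : tens H H :=
  (t HH HH : hhom (HH ** HH) (HH ** HH)) (1 \ox 1).

(** On pure tensors this is naturality of [t] along the maps [h |-> h x] and
    [h |-> h y], which send [1 \ox 1] to [x \ox y]; both sides are additive. *)
Lemma ibr_act (t : inf_braiding C) (X Y : hmod H) (v : X ** Y) :
  (t X Y : hhom (X ** Y) (X ** Y)) v = act2 X Y (ibr_elt t) v.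
Proof.
elim/tens_indW: v => [|x y v ih]; first by rewrite linear0 lact0r.
rewrite linearD lactDr /= ih; congr (_ + _).
pose f := orbit_hom x; pose g := orbit_hom y.
have xyE : x \ox y = htmor Q f g (1 \ox 1).
  by rewrite /= /htmor_fun tmapE /= !lact1.
have natE : (t X Y : hhom (X ** Y) (X ** Y)) (htmor Q f g (1 \ox 1)) =
    htmor Q f g (ibr_elt t).
  exact: (congr1 (fun u : hhom (HH ** HH) (X ** Y) => u (1 \ox 1))
    (@ibr_nat C t HH X HH Y f g)).
rewrite xyE natE /= /htmor_fun -act2_map; congr (tmap f g _).
(* The action on the regular module is multiplication, and 1 \ox 1 is the unit. *)
exact: (esym (mulr1 (ibr_elt t))).
Qed.

(** The action on the regular module is multiplication, so the value at the
    unit [1 \ox (1 \ox 1)] recovers the acting element. *)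
Lemma act3_reg_inj (a b : tens H (tens H H)) :
  (forall v, act3 HH HH HH a v = act3 HH HH HH b v) -> a = b.
Proof. by move=> /(_ 1) ab; rewrite -[a]mulr1 -[b]mulr1; exact: ab. Qed.

Lemma ibr_eltP (t : inf_braiding C) : is_inf_Rmatrix Q (ibr_elt t).
Proof.
split=> [h||].
- (* H-linearity of the component at the regular module, evaluated at the unit. *)
  have := hfunP (t HH HH : hhom (HH ** HH) (HH ** HH)) h (1 : tens H H).
  rewrite !ibr_act !hact_htens -!lactM => e.
  by rewrite -[LHS]mulr1 -[RHS]mulr1; exact: e.
- apply: act3_reg_inj => v; rewrite -(ib_tensr_act (ibr_act t)) -act2_htensr.
  by rewrite -ibr_act (@ibr_tensr C t HH HH HH).
- apply: act3_reg_inj => v; rewrite -[v](tassocVK v).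
  rewrite -(ib_tensl_act (ibr_act t)) -act2_htensl -ibr_act.
  by rewrite (@ibr_tensl C t HH HH HH).
Qed.

Definition inf_Rmatrix_of (t : inf_braiding C) : inf_Rmatrix Q :=
  exist _ (ibr_elt t) (ibr_eltP t).

Lemma inf_braiding_ext (t u : inf_braiding C) :
  (forall X Y : hmod H, (t X Y : hhom (X ** Y) (X ** Y)) =1
    (u X Y : hhom (X ** Y) (X ** Y))) -> t = u.
Proof.
case: t u => [t tn tr tl] [u un ur ul] /= tu.
have {}tu : t = u.
  apply: functional_extensionality_dep => X.
  apply: functional_extensionality_dep => Y.
  exact: (@hhom_ext k H (X ** Y) (X ** Y) _ _ (tu X Y)).
by subst u; congr InfBraiding; apply: Prop_irrelevance.
Qed.

Lemma inf_braiding_ofK : cancel inf_braiding_of inf_Rmatrix_of.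
Proof. by case=> chi chiP; apply: eq_exist; exact: (mulr1 chi). Qed.

Lemma inf_Rmatrix_ofK : cancel inf_Rmatrix_of inf_braiding_of.
Proof. by move=> t; apply: inf_braiding_ext => X Y v; rewrite [RHS]ibr_act. Qed.

End InfinitesimalBraidings.

Theorem theorem3p8 (k : fieldType) (char0 : [pchar k] =i pred0)
    (H : algType k) (Q : quasitriangular H) :
  exists (F : inf_Rmatrix Q -> inf_braiding (hmod_braided Q))
         (G : inf_braiding (hmod_braided Q) -> inf_Rmatrix Q),
    [/\ cancel F G,
        cancel G F,
        forall (chi : inf_Rmatrix Q) (X Y : hmod H) (x : X) (y : Y),
          (F chi X Y : hhom (htens Q X Y) (htens Q X Y)) (x \ox y) =
          act2 X Y (sval chi) (x \ox y)
      & forall t : inf_braiding (hmod_braided Q),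
          sval (G t) =
          (t (hmod_reg H) (hmod_reg H) :
             hhom (htens Q (hmod_reg H) (hmod_reg H))
                  (htens Q (hmod_reg H) (hmod_reg H))) (1 \ox 1)].
Proof.
exists (@inf_braiding_of k H Q), (@inf_Rmatrix_of k H Q); split=> //.
- exact: inf_braiding_ofK.
- exact: inf_Rmatrix_ofK.
Qed.
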